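(* Let $I\subset\mathbb R$ be a compact interval with interior $I^\circ$, and let $\psi\in C^\infty(I)$ be real valued with $\psi(t)-t\psi'(t)\neq 0$ for all $t\in I$. Let $b\in C_0^\infty(\mathbb R^2)$ with $\operatorname{supp}(b)\subset I^\circ\times\mathbb R$ and $b=0$ near the origin. For $\lambda,\theta\in\mathbb R$ put $$\varphi_{\lambda,\theta}(r)=\begin{cases} r^\lambda(\log(2+r^{-1}))^{-\theta}, & r>0,\\ 0,& r\le0,\end{cases}\qquad \Psi_{\lambda,\theta}(\xi)=b(\xi)\,\varphi_{\lambda,\theta}(\xi_2-\psi(\xi_1)).$$ Then there is a constant $C_{\lambda,\theta}$ such that $$\|g_{\mathscr F^{-1}(\Psi_{\lambda,\theta})}(f)\|_2\le C_{\lambda,\theta}\|f\|_2\qquad\text{for all } f\in\mathscr S(\mathbb R^2)$$ if $\lambda=-1/2$ and $\theta>1$; this also holds for every $\theta\in\mathbb R$ when $\lambda>-1/2$.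
   Context: $\mathscr S(\mathbb R^2)$ is the Schwartz space and $\|\cdot\|_p$ is the $L^p(\mathbb R^2)$ norm. The Fourier transform is $\mathscr F(f)(\xi)=\hat f(\xi)=\int_{\mathbb R^2}f(x)e^{-2\pi i\langle x,\xi\rangle}\,dx$, and $\mathscr F^{-1}$ is its inverse. The Littlewood-Paley function of $f$ associated with $h$ is $$g_h(f)(x)=\Big(\int_0^\infty|h_t*f(x)|^2\,\frac{dt}t\Big)^{1/2},\qquad h_t(x)=t^{-2}h(t^{-1}x).$$ *)

(* Defs.v *)
From HB Require Import structures.
From mathcomp Require Import all_boot all_order all_algebra.
From mathcomp Require Import all_classical all_reals all_analysis.
From mathcomp Require Import complex.
Set Implicit Arguments.
Unset Strict Implicit.
Unset Printing Implicit Defensive.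
Import Order.TTheory GRing.Theory Num.Theory.
Import numFieldNormedType.Exports.
Local Open Scope classical_set_scope.
Local Open Scope ring_scope.
Local Open Scope complex_scope.

(* Derivative relative to [A]: one-sided at the endpoints when [A] is a compact
   interval. *)
Definition difference_quotient (R : realType) (f : R -> R) (x y : R) : R :=
  (f y - f x) / (y - x).

Definition derivable_within (R : realType) (A : set R) (f : R -> R) (x : R) :
    Prop :=
  cvg (difference_quotient f x y @[y --> within A x^']).

Definition derive_within (R : realType) (A : set R) (f : R -> R) (x : R) : R :=
  lim (difference_quotient f x y @[y --> within A x^']).

(* C^oo(A) for an interval A that may contain its endpoints; the values of the
   iterated derivatives outside A are irrelevant. *)
Definition smooth_within (R : realType) (A : set R) (f : R -> R) : Prop :=
  forall (n : nat) (x : R), A x ->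
    derivable_within A (iter n (derive_within A) f) x.

Definition coord_vector (R : realType) (i : bool) : R * R :=
  if i then (0, 1) else (1, 0).

(* Iterated partial derivative along the word [w]; [false] stands for the first
   variable and [true] for the second. *)
Definition partials (R : realType) (w : seq bool) (f : R * R -> R) :
    R * R -> R :=
  foldr (fun i g => 'D_(coord_vector R i) g) f w.

Definition smooth2 (R : realType) (f : R * R -> R) : Prop :=
  forall w : seq bool, continuous (partials w f) /\
    forall x i, derivable (partials w f) x (coord_vector R i).

(* R[i] has no topology as a real vector space in the library, hence
   differentiation and integration of complex functions are componentwise. *)
Definition csmooth2 (R : realType) (f : R * R -> R[i]) : Prop :=
  smooth2 (fun x => complex.Re (f x)) /\ smooth2 (fun x => complex.Im (f x)).

Definition cpartials (R : realType) (w : seq bool) (f : R * R -> R[i])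
    (x : R * R) : R[i] :=
  partials w (fun y => complex.Re (f y)) x +i* partials w (fun y => complex.Im (f y)) x.

Definition cabs (R : realType) (z : R[i]) : R := ComplexField.Normc.normc z.

Definition schwartz (R : realType) (f : R * R -> R[i]) : Prop :=
  csmooth2 f /\
  forall (m n : nat) (w : seq bool), exists C : R, forall x : R * R,
    `|x.1| ^+ m * `|x.2| ^+ n * cabs (cpartials w f x) <= C.

Definition csupport (R : realType) (f : R * R -> R[i]) : set (R * R) :=
  closure [set x | f x != 0].

Definition smooth_compact_support (R : realType) (f : R * R -> R[i]) : Prop :=
  csmooth2 f /\ compact (csupport f).

Definition lebesgue2 (R : realType) :=
  (@lebesgue_measure R \x @lebesgue_measure R)%E.

Definition cintegral2 (R : realType) (F : R * R -> R[i]) : R[i] :=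
  (\int[@lebesgue2 R]_x complex.Re (F x)) +i* (\int[@lebesgue2 R]_x complex.Im (F x)).

Definition dot2 (R : realType) (x y : R * R) : R := x.1 * y.1 + x.2 * y.2.

Definition expi (R : realType) (u : R) : R[i] := cos u +i* sin u.

(* The integral formula, meaningful for integrable [F]. *)
Definition inverse_fourier (R : realType) (F : R * R -> R[i]) (x : R * R) :
    R[i] :=
  cintegral2 (fun xi => F xi * expi (2 * pi * dot2 x xi)).

Definition convolution (R : realType) (h f : R * R -> R[i]) (x : R * R) :
    R[i] :=
  cintegral2 (fun y => h (x - y) * f y).

Definition dilation (R : realType) (h : R * R -> R[i]) (t : R) (x : R * R) :
    R[i] :=
  (t ^- 2)%:C * h (t^-1 * x.1, t^-1 * x.2).

Definition littlewood_paley (R : realType) (h f : R * R -> R[i]) (x : R * R) :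
    \bar R :=
  ((\int[@lebesgue_measure R]_(t in `]0%R, +oo[)
     (cabs (convolution (dilation h t) f x) ^+ 2 / t)%:E) `^ 2^-1)%E.

Definition norm2 (R : realType) (F : R * R -> \bar R) : \bar R :=
  'N[@lebesgue2 R]_2%:E[F]%E.

Definition phi (R : realType) (lambda theta r : R) : R :=
  if 0 < r then r `^ lambda * ln (2 + r^-1) `^ (- theta) else 0.

Definition Psi (R : realType) (psi : R -> R) (b : R * R -> R[i])
    (lambda theta : R) (xi : R * R) : R[i] :=
  b xi * (phi lambda theta (xi.2 - psi xi.1))%:C.

(* Main.v *)
Require Import Defs.
From HB Require Import structures.
From mathcomp Require Import all_boot all_order all_algebra.
From mathcomp Require Import all_classical all_reals all_analysis.
From mathcomp Require Import measurable_realfun complex.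
From mathcomp Require Import ring lra.
Set Implicit Arguments.
Unset Strict Implicit.
Unset Printing Implicit Defensive.
Import Order.TTheory GRing.Theory Num.Theory.
Import numFieldNormedType.Exports.
Local Open Scope classical_set_scope.
Local Open Scope ring_scope.
Local Open Scope complex_scope.

(** By the Plancherel theorem the square function of a multiplier operator is
    controlled by the mass of the multiplier along rays: formally
      ||g_h f||_2^2 = int |hat f(xi)|^2 (int_0^oo |Psi(t xi)|^2 dt/t) dxi,
    so the theorem follows once int_0^oo |Psi(t xi)|^2 dt/t is bounded uniformly
    in xi ([littlewood_paley_multiplier], [radial_square_integral]).

    Ray integrals.  Put u(t) = t xi_2 - psi(t xi_1), the argument of phi on the
    ray.  The quotient u(t)/t = xi_2 - psi(t xi_1)/t has derivative
    (psi(s) - s psi'(s))/t^2 at s = t xi_1, which by hypothesis has a constant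
    sign and is bounded away from zero.  Hence, up to the bounded factor t/rho,
    u is a strictly monotone function v of t with |v'| >= const/t.  On the other
    hand phi^2 is dominated by the derivative of 1/ln(2 + 1/r)
    ([phi_sqr_le]): this is immediate from r^(-1) ln^(-2 theta) <= C r^(-1) ln^(-2)
    when lambda = -1/2 and theta > 1, and holds with room to spare when
    lambda > -1/2.  The chain rule turns the ray integral into the integral of
    a derivative of the bounded function 1/ln(2 + 1/v), whatever xi is
    ([log_density_substitution]).  The same primitive shows that Psi is
    integrable ([cintegrable_Psi]), which gives a meaning to the kernel.

    Plancherel up to a constant.  An explicit constant is irrelevant here, so
    only the inequality ||hat G||_2 <= C ||G||_2 for integrable G is proved.
    A phase exp(i s y.x) is split into products of sines and cosines of one
    coordinate each; every such real transform T is bounded through T T^*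
    ([TTstar_bound]): after inserting the weight 1 - (y/N)^2 on [-N, N] in each
    coordinate of y, the kernel of T^* k T is a product of two one-dimensional
    kernels, each dominated by a sum of Poisson-type kernels N/(1 + N^2 w^2),
    whose integrals do not depend on N
    ([welch_cos_bound], [integral_trig_kernel]).  Letting N tend to infinity
    gives [trig_transform_L2], and [cintegral2_phase_L2] for complex functions.

    The inequality is used twice: for f itself, and for
    xi |-> t^(-2) Psi(xi) hat f(xi/t), whose inverse transform at x/t is
    h_t * f (x) ([convolution_dilation_fourier]).  Tonelli's theorem then exchanges the
    integrals in t and xi. *)

(** * Lebesgue measure on the plane; integrals depending on a parameter *)

(** The product structure of [lebesgue2] is hidden behind its name;
    sigma-finiteness is what makes Fubini's theorem apply when the plane
    itself is one of the factors. *)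
Lemma lebesgue2_sigma_finite (R : realType) :
  sigma_finite setT (@lebesgue2 R).
Proof.
have /sigma_finiteP[F [TF ndF Foo]] := sigma_finiteT (@lebesgue_measure R).
exists (fun n => F n `*` F n).
  rewrite -setXTT TF predeqE => -[x y]; split.
    move=> [/= [n _ Fnx] [k _ Fky]]; exists (maxn n k) => //; split.
    - by move: x Fnx; exact/subsetPset/ndF/leq_maxl.
    - by move: y Fky; exact/subsetPset/ndF/leq_maxr.
  by move=> [n _ []/= ? ?]; split; exists n.
move=> k; have [? ?] := Foo k.
split; first exact: measurableX.
by rewrite /lebesgue2 product_measure1E// lte_mul_pinfty// ge0_fin_numE.
Qed.

HB.instance Definition _ (R : realType) := Measure.copy (@lebesgue2 R)
  (@lebesgue_measure R \x @lebesgue_measure R)%E.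
HB.instance Definition _ (R : realType) :=
  Measure_isSigmaFinite.Build _ _ _ (@lebesgue2 R) (@lebesgue2_sigma_finite R).

Section product_integrals.
Context d1 d2 (X : measurableType d1) (Y : measurableType d2) (R : realType).
Variable mu : {sigma_finite_measure set X -> \bar R}.
Variable nu : {sigma_finite_measure set Y -> \bar R}.

Lemma measurable_parametric_Rintegral (f : X * Y -> R) :
  measurable_fun setT f ->
  measurable_fun setT (fun x => \int[nu]_y f (x, y)).
Proof.
move=> mf.
rewrite -[X in measurable_fun _ X]/(fine \o (fun x => \int[nu]_y (f (x, y))%:E)%E).
apply: (measurableT_comp (@fine_measurable R setT measurableT)).
under eq_fun do rewrite integralE.
have mEf : measurable_fun setT (EFin \o f) by exact/measurable_EFinP.
apply: emeasurable_funB.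
  have := measurable_fun_fubini_tonelli_F (m2 := nu) _
    (measurable_funepos mEf) (fun x => funepos_ge0 _ x).
  apply: eq_measurable_fun => x _; apply: eq_integral => y _.
  by rewrite !funeposE.
have := measurable_fun_fubini_tonelli_F (m2 := nu) _
  (measurable_funeneg mEf) (fun x => funeneg_ge0 _ x).
apply: eq_measurable_fun => x _; apply: eq_integral => y _.
by rewrite !funenegE.
Qed.

Lemma integrable_tensor (f : X * Y -> R) (a : X -> R) (b : Y -> R) :
  measurable_fun setT f ->
  mu.-integrable setT (EFin \o a) -> nu.-integrable setT (EFin \o b) ->
  (forall x y, `|f (x, y)| <= a x * b y) ->
  (mu \x nu)%E.-integrable setT (EFin \o f).
Proof.
move=> mf ia ib fab; apply/integrable12ltyP; first exact/measurable_EFinP.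
have /integrableP[ma lta] := ia; have /integrableP[mb ltb] := ib.
have a0 : (0 <= \int[mu]_x `|(EFin \o a) x|)%E by apply: integral_ge0.
have b0 : (0 <= \int[nu]_x `|(EFin \o b) x|)%E by apply: integral_ge0.
have mf' : measurable_fun setT (fun z => `|(f z)%:E|%E).
  by apply: measurableT_comp => //; exact/measurable_EFinP.
apply: (@le_lt_trans _ _
    (\int[mu]_x (`|(EFin \o a) x| * \int[nu]_y `|(EFin \o b) y|)))%E.
  apply: ge0_le_integral => //.
  - by move=> x _; apply: integral_ge0.
  - exact: (measurable_fun_fubini_tonelli_F _ mf').
  - apply: emeasurable_funM => //; exact: measurableT_comp.
  - move=> x _; rewrite -ge0_integralZl//; last exact: measurableT_comp.
    apply: ge0_le_integral => //.
    + by apply: (measurableT_comp mf').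
    + by apply: emeasurable_funM => //; exact: measurableT_comp.
    + by move=> y _; rewrite lee_fin -normrM (le_trans (fab _ _))// ler_norm.
rewrite ge0_integralZr//; last exact: measurableT_comp.
by rewrite lte_mul_pinfty// ge0_fin_numE.
Qed.

(** Pointwise domination by a tensor product makes every section integrable,
    not only almost every one, so no exceptional set appears and real-valued
    integrals can be used throughout. *)
Lemma Rintegral_prodE (f : X * Y -> R) (a : X -> R) (b : Y -> R) :
  measurable_fun setT f ->
  mu.-integrable setT (EFin \o a) -> nu.-integrable setT (EFin \o b) ->
  (forall x y, `|f (x, y)| <= a x * b y) ->
  (\int[(mu \x nu)%E]_z f z = \int[mu]_x \int[nu]_y f (x, y)) /\
  (\int[(mu \x nu)%E]_z f z = \int[nu]_y \int[mu]_x f (x, y)).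
Proof.
move=> mf ia ib fab.
have int_f := integrable_tensor mf ia ib fab.
have f1 x : nu.-integrable setT (EFin \o (fun y => f (x, y))).
  apply: (@le_integrable _ _ _ _ _ measurableT _
    (fun y => (a x)%:E * (EFin \o b) y)%E).
  - by apply/measurable_EFinP; exact: measurableT_comp.
  - by move=> y _ /=; rewrite lee_fin (le_trans (fab _ _))// ler_norm.
  - exact: integrableZl.
have f2 y : mu.-integrable setT (EFin \o (fun x => f (x, y))).
  apply: (@le_integrable _ _ _ _ _ measurableT _
    (fun x => (EFin \o a) x * (b y)%:E)%E).
  - by apply/measurable_EFinP; exact: measurableT_comp.
  - by move=> x _ /=; rewrite lee_fin (le_trans (fab _ _))// ler_norm.
  - exact: integrableZr.
split; rewrite /Rintegral.
  rewrite -(integral12_prod_meas1 int_f)/fubini_F; congr fine.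
  by apply: eq_integral => x _; rewrite fineK// (integrable_fin_num _ (f1 x)).
rewrite -(integral21_prod_meas1 int_f)/fubini_G; congr fine.
by apply: eq_integral => x _; rewrite fineK// (integrable_fin_num _ (f2 x)).
Qed.

Lemma Rintegral_exchange (f : X * Y -> R) (a : X -> R) (b : Y -> R) :
  measurable_fun setT f ->
  mu.-integrable setT (EFin \o a) -> nu.-integrable setT (EFin \o b) ->
  (forall x y, `|f (x, y)| <= a x * b y) ->
  \int[mu]_x \int[nu]_y f (x, y) = \int[nu]_y \int[mu]_x f (x, y).
Proof. by move=> mf ia ib fab; have [<- <-] := Rintegral_prodE mf ia ib fab. Qed.

End product_integrals.

(** * The T T* argument *)

(** A divergent real integral has the value 0 by convention, so that it cannot
    violate the bound. *)
Lemma normr_Rintegral_le d (X : measurableType d) (R : realType)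
    (mu : {measure set X -> \bar R}) (f : X -> R) :
  measurable_fun setT f ->
  ((`|\int[mu]_x f x|)%:E <= \int[mu]_x (`|f x|)%:E)%E.
Proof.
move=> mf; apply: (@le_trans _ _ `|\int[mu]_x (f x)%:E|%E); last first.
  by apply: (@le_abse_integral _ _ _ mu setT (EFin \o f)) => //; exact/measurable_EFinP.
by rewrite /Rintegral; case: (integral _ _ _) => [r| |] //=; rewrite normr0 leey.
Qed.

Section TTstar.
Context d1 d2 (X : measurableType d1) (Y : measurableType d2) (R : realType).
Variable mu : {sigma_finite_measure set X -> \bar R}.
Variable nu : {sigma_finite_measure set Y -> \bar R}.

(** Write [T g y = int_x c (y, x) g x].  Then [int_y k (T g)^2 = int_x g (T^* k T g)],
    and [T^* k T] has the kernel whose absolute value is bounded by [M].  Since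
    [|g x| |g x'| <= g x ^ 2 + g x' ^ 2], bounds on the marginals of [M] are
    enough (Schur's test). *)
Lemma TTstar_bound (c : Y * X -> R) (k : Y -> R) (g : X -> R)
    (M : X * X -> R) (B : R) :
  measurable_fun setT c -> (forall z, `|c z| <= 1) ->
  (forall y, 0 <= k y) -> nu.-integrable setT (EFin \o k) ->
  mu.-integrable setT (EFin \o g) ->
  measurable_fun setT M ->
  (forall x x', `|\int[nu]_y (k y * (c (y, x) * c (y, x')))| <= M (x, x')) ->
  (forall x, \int[mu]_x' (M (x, x'))%:E <= B%:E)%E ->
  (forall x', \int[mu]_x (M (x, x'))%:E <= B%:E)%E ->
  (\int[nu]_y (k y * (\int[mu]_x (c (y, x) * g x)) ^+ 2)%:E
    <= (2 * B)%:E * \int[mu]_x ((g x) ^+ 2)%:E)%E.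
Proof.
move=> mc c1 k0 ik ig mM cM MB MB'.
have M0 z : 0 <= M z by case: z => x x'; rewrite (le_trans _ (cM x x')).
have mk : measurable_fun setT k by exact/measurable_EFinP/(measurable_int _ ik).
have mg : measurable_fun setT g by exact/measurable_EFinP/(measurable_int _ ig).
have mcy x : measurable_fun setT (fun y => c (y, x)) by exact: measurableT_comp.
have mcx y : measurable_fun setT (fun x => c (y, x)) by exact: measurableT_comp.
pose A y := \int[mu]_x (c (y, x) * g x).
pose G := \int[mu]_x `|g x|.
have icg y : mu.-integrable setT (EFin \o (fun x => c (y, x) * g x)).
  apply: (@le_integrable _ _ _ _ _ measurableT _ (EFin \o g)) => //.
    by apply/measurable_EFinP; exact: measurable_funM.
  by move=> x _; rewrite lee_fin normrM ler_piMl.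
have iag : mu.-integrable setT (EFin \o (fun x => `|g x|)).
  exact: (integrable_norm ig).
have AG y : `|A y| <= G.
  rewrite (le_trans (le_normr_Rintegral _ (icg y)))//.
  apply: le_Rintegral => //; first exact: (integrable_norm (icg y)).
  by move=> x _; rewrite normrM ler_piMl.
have G0 : 0 <= G by exact: le_trans (normr_ge0 _) (AG point).
have mA : measurable_fun setT A.
  apply: (@measurable_parametric_Rintegral _ _ Y X _ mu
    (fun z => c z * g z.2)).
  by apply: measurable_funM => //; exact: measurableT_comp.
pose P x := \int[nu]_y (k y * A y * c (y, x)).
pose Q x x' := \int[nu]_y (k y * (c (y, x) * c (y, x'))).
have iZk r : nu.-integrable setT (EFin \o (fun y => r * k y)).
  by rewrite -[X in integrable _ _ X]/(fun y => r%:E * (EFin \o k) y)%E;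
    exact: integrableZl.
have ikAA : nu.-integrable setT (EFin \o (fun y => k y * A y ^+ 2)).
  apply: (@le_integrable _ _ _ _ _ measurableT _
    (EFin \o (fun y => G ^+ 2 * k y))) => //.
  - by apply/measurable_EFinP; apply: measurable_funM => //; apply: measurable_funX.
  - move=> y _; rewrite lee_fin mulrC [leLHS]normrM [leRHS]normrM ler_wpM2r//.
    by rewrite [leLHS]normrX [leRHS]normrX lerXn2r ?nnegrE// (ger0_norm G0).
have ikAc x : nu.-integrable setT (EFin \o (fun y => k y * A y * c (y, x))).
  apply: (@le_integrable _ _ _ _ _ measurableT _ (EFin \o (fun y => G * k y))) => //.
  - by apply/measurable_EFinP; do 2 apply: measurable_funM => //.
  - move=> y _; rewrite lee_fin !normrM (le_trans (ler_piMr _ (c1 _)))//.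
    by rewrite mulrC ler_wpM2r// (ger0_norm G0).
have mkz : measurable_fun setT (fun z : Y * X => k z.1) by exact: measurableT_comp.
have mAz : measurable_fun setT (fun z : Y * X => A z.1) by exact: measurableT_comp.
have mgz : measurable_fun setT (fun z : Y * X => g z.2) by exact: measurableT_comp.
(* The left side is the pairing of g with P, the image of k * A under T^*. *)
have step1 : \int[nu]_y (k y * A y ^+ 2) = \int[mu]_x (g x * P x).
  transitivity (\int[nu]_y \int[mu]_x (k y * A y * c (y, x) * g x)).
    apply: eq_Rintegral => y _; rewrite expr2 mulrA -RintegralZl//.
    by apply: eq_Rintegral => x _; rewrite mulrA.
  rewrite (@Rintegral_exchange _ _ _ _ _ nu mu
    (fun z => k z.1 * A z.1 * c z * g z.2) (fun y => G * k y) (fun x => `|g x|))//.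
  - by apply: eq_Rintegral => x _; rewrite mulrC -RintegralZr.
  - by do 3 apply: measurable_funM => //.
  - move=> y x; rewrite !normrM ler_wpM2r// (le_trans (ler_piMr _ (c1 _)))//.
    by rewrite mulrC (ger0_norm (k0 _)) ler_wpM2r.
have icc x x' : nu.-integrable setT (EFin \o (fun y => k y * (c (y, x) * c (y, x')))).
  apply: (@le_integrable _ _ _ _ _ measurableT _ (EFin \o k)) => //.
  - by apply/measurable_EFinP; do 2 apply: measurable_funM => //.
  - move=> y _; rewrite lee_fin !normrM.
    by rewrite ler_piMr// mulr_ile1.
have step2 x : P x = \int[mu]_x' (Q x x' * g x').
  transitivity (\int[nu]_y \int[mu]_x' (k y * (c (y, x) * c (y, x')) * g x')).
    apply: eq_Rintegral => y _; rewrite mulrAC -RintegralZl//.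
    by apply: eq_Rintegral => x' _; ring.
  rewrite (@Rintegral_exchange _ _ _ _ _ nu mu
    (fun z => k z.1 * (c (z.1, x) * c z) * g z.2) k (fun x => `|g x|))//.
  - by apply: eq_Rintegral => x' _; rewrite -RintegralZr.
  - do 3 apply: measurable_funM => //.
    exact: (measurableT_comp (mcy x)).
  - move=> y x'; rewrite !normrM ler_wpM2r// (ger0_norm (k0 _)).
    by rewrite ler_piMr// mulr_ile1.
have -> : (\int[nu]_y (k y * A y ^+ 2)%:E = (\int[nu]_y (k y * A y ^+ 2))%:E)%E.
  by rewrite /Rintegral fineK// (integrable_fin_num _ ikAA).
have mP : measurable_fun setT P.
  apply: (@measurable_parametric_Rintegral _ _ X Y _ nu
    (fun z => k z.2 * A z.2 * c (z.2, z.1))).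
  apply: measurable_funM; first by apply: measurable_funM; exact: measurableT_comp.
  by apply: measurableT_comp => //; exact: measurable_fun_pair.
have mQ x : measurable_fun setT (Q x).
  apply: (@measurable_parametric_Rintegral _ _ X Y _ nu
    (fun z => k z.2 * (c (z.2, x) * c (z.2, z.1)))).
  apply: measurable_funM; first exact: measurableT_comp.
  apply: measurable_funM; first exact: (measurableT_comp (mcy x)).
  by apply: measurableT_comp => //; exact: measurable_fun_pair.
have mMx x : measurable_fun setT (fun x' => (M (x, x'))%:E).
  by apply/measurable_EFinP; exact: measurableT_comp.
have mMx' x' : measurable_fun setT (fun x => (M (x, x'))%:E).
  by apply/measurable_EFinP; exact: measurableT_comp.
have mg2 : measurable_fun setT (fun x => (g x ^+ 2)%:E).
  by apply/measurable_EFinP; exact: measurable_funX.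
rewrite step1.
apply: (@le_trans _ _ (\int[mu]_x (`|g x * P x|)%:E)%E).
  apply: le_trans (normr_Rintegral_le _ _); first by rewrite lee_fin ler_norm.
  exact: measurable_funM.
(* |g x| |g x'| |Q x x'| is dominated by the function F; its two summands are
   integrated in opposite orders. *)
pose F z := (((g z.1) ^+ 2 + (g z.2) ^+ 2) * M z)%:E.
have mF : measurable_fun setT F.
  by apply/measurable_EFinP; apply: measurable_funM => //;
    apply: measurable_funD; apply: measurable_funX; exact: measurableT_comp.
have F0 z : (0 <= F z)%E by rewrite lee_fin mulr_ge0// addr_ge0// sqr_ge0.
apply: (@le_trans _ _ (\int[mu]_x \int[mu]_x' F (x, x'))%E).
  apply: ge0_le_integral => //.
  - by apply/measurable_EFinP; apply: measurableT_comp => //; exact: measurable_funM.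
  - exact: (measurable_fun_fubini_tonelli_F F mF F0).
  move=> x _; rewrite normrM EFinM step2.
  apply: (@le_trans _ _ (`|g x|%:E * \int[mu]_x' (`|Q x x' * g x'|)%:E)%E).
    by apply: lee_wpmul2l => //; apply: normr_Rintegral_le; exact: measurable_funM.
  rewrite -ge0_integralZl//; last first.
    by apply/measurable_EFinP; apply: measurableT_comp => //; exact: measurable_funM.
  apply: ge0_le_integral => //.
  - apply: emeasurable_funM => //.
    by apply/measurable_EFinP; apply: measurableT_comp => //; exact: measurable_funM.
  - exact: measurableT_comp.
  - move=> x' _; rewrite /F -EFinM lee_fin normrM mulrCA mulrC.
    apply: ler_pM; rewrite ?mulr_ge0//; last exact: cM.
    rewrite /= -(real_normK (num_real (g x))) -(real_normK (num_real (g x'))).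
    by have := sqr_ge0 (`|g x| - `|g x'|); have := sqr_ge0 (`|g x| + `|g x'|); nra.
pose F1 z := ((g z.1) ^+ 2 * M z)%:E.
pose F2 z := ((g z.2) ^+ 2 * M z)%:E.
have mF1 : measurable_fun setT F1.
  by apply/measurable_EFinP; apply: measurable_funM => //;
    apply: measurable_funX; exact: measurableT_comp.
have mF2 : measurable_fun setT F2.
  by apply/measurable_EFinP; apply: measurable_funM => //;
    apply: measurable_funX; exact: measurableT_comp.
have F10 z : (0 <= F1 z)%E by rewrite lee_fin mulr_ge0// sqr_ge0.
have F20 z : (0 <= F2 z)%E by rewrite lee_fin mulr_ge0// sqr_ge0.
have FE x : (\int[mu]_x' F (x, x') = \int[mu]_x' F1 (x, x') + \int[mu]_x' F2 (x, x'))%E.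
  rewrite -ge0_integralD//; try exact: measurableT_comp.
  by apply: eq_integral => x' _; rewrite /F /F1 /F2 mulrDl EFinD.
under eq_integral do rewrite FE.
rewrite ge0_integralD//; first last.
- exact: (measurable_fun_fubini_tonelli_F F2 mF2 F20).
- by move=> x _; exact: integral_ge0.
- exact: (measurable_fun_fubini_tonelli_F F1 mF1 F10).
- by move=> x _; exact: integral_ge0.
have B0 : (0 <= B%:E)%E.
  by rewrite (le_trans _ (MB point))// integral_ge0// => x _; rewrite lee_fin.
rewrite (fubini_tonelli F2)// mulrDl mul1r EFinD ge0_muleDl//.
apply: leeD.
  rewrite -ge0_integralZl//; last by move=> x _; rewrite lee_fin sqr_ge0.
  apply: ge0_le_integral => //.
  - by move=> x _; exact: integral_ge0.
  - exact: (measurable_fun_fubini_tonelli_F F1 mF1 F10).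
  - by apply: emeasurable_funM.
  move=> x _; rewrite /F1 /=; under eq_integral do rewrite EFinM.
  rewrite ge0_integralZl//; last 2 first.
  - by move=> x' _; rewrite lee_fin.
  - by rewrite lee_fin sqr_ge0.
  by rewrite muleC lee_wpmul2r// lee_fin sqr_ge0.
rewrite -ge0_integralZl//; last by move=> x _; rewrite lee_fin sqr_ge0.
apply: ge0_le_integral => //.
- by move=> x _; exact: integral_ge0.
- exact: (measurable_fun_fubini_tonelli_G F2 mF2 F20).
- by apply: emeasurable_funM.
move=> x _; rewrite /F2 /=; under eq_integral do rewrite EFinM.
rewrite ge0_integralZl//; last 2 first.
- by move=> x' _; rewrite lee_fin.
- by rewrite lee_fin sqr_ge0.
by rewrite muleC lee_wpmul2r// lee_fin sqr_ge0.
Qed.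

End TTstar.

(** * Integrals of derivatives over open intervals *)

Section FTC.
Context (R : realType).
Local Notation leb := (@lebesgue_measure R).

Lemma integral_derivative_segment (f F : R -> R) (a b : R) : a <= b ->
  (forall x, a <= x <= b -> is_derive x 1 F (f x)) ->
  (forall x, a <= x <= b -> {for x, continuous f}) ->
  (\int[leb]_(x in `[a, b]) (f x)%:E = (F b - F a)%:E)%E.
Proof.
rewrite le_eqVlt => /predU1P[<- _ _|ab dF cf].
  by rewrite set_itv1 integral_set1 subrr.
have dF' x : a <= x <= b -> derivable F x 1 by move=> /dF [].
have cF x : a <= x <= b -> {for x, continuous F}.
  by move=> /dF'/derivable1_diffP/differentiable_continuous.
rewrite (@continuous_FTC2 _ f F)//.
- apply: continuous_in_subspaceT => x; rewrite inE/= in_itv/= => xab.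
  exact: cf.
- split.
  + by move=> x; rewrite in_itv/= => /andP[ax xb]; apply: dF'; rewrite !ltW.
  + by apply: cvg_at_right_filter; apply: cF; rewrite lexx ltW.
  + by apply: cvg_at_left_filter; apply: cF; rewrite lexx ltW.
- move=> x; rewrite in_itv/= => /andP[ax xb].
  by rewrite derive1E; apply: derive_val; apply: dF; rewrite !ltW.
Qed.

(** The interval may be unbounded and [F] need not extend to its end points:
    only the oscillation of [F] counts, and it is at most [2 * B]. *)
Lemma integral_derivative_le (f F : R -> R) (E : set R) (B : R) :
  is_interval E -> open E ->
  (forall x, E x -> is_derive x 1 F (f x)) ->
  (forall x, E x -> {for x, continuous f}) ->
  (forall x, E x -> 0 <= f x) -> 0 <= B ->
  (forall x, E x -> `|F x| <= B) ->
  (\int[leb]_(x in E) (f x)%:E <= (2 * B)%:E)%E.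
Proof.
move=> iE oE dF cf f0 B0 FB.
(* The points that are 1/(n+1)-deep inside E and bounded by n: their convex hull
   is a compact segment contained in E. *)
pose K n := [set x : R | `|x| <= n%:R /\ E (x - n.+1%:R^-1) /\ E (x + n.+1%:R^-1)].
have KE n : K n `<=` E.
  move=> x [_ [xl xr]]; apply: (iE _ _ xl xr).
  by rewrite gerBl lerDl invr_ge0 ler0n.
have nV n : 0 < n.+1%:R^-1 :> R by rewrite invr_gt0.
have KI n : is_interval (K n).
  move=> x y [xn [xl xr]] [yn [yl yr]] z /andP[xz zy]; split; [|split].
  - rewrite ler_norml; move: xn yn; rewrite !ler_norml => /andP[? _] /andP[_ ?].
    by apply/andP; split; [exact: le_trans xz|exact: (le_trans zy)].
  - by apply: (iE _ _ xl yl); rewrite !lerD2r xz.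
  - by apply: (iE _ _ xr yr); rewrite !lerD2r xz.
have mK n : measurable (K n) by exact: is_interval_measurable.
have mE : measurable E by exact: open_measurable.
have mf : measurable_fun E f.
  apply: open_continuous_measurable_fun => //.
  by move=> x /set_mem; exact: cf.
have UK : E = \bigcup_n K n.
  apply/seteqP; split; last by move=> x [n _ /KE].
  move=> x Ex.
  have /nbhs_ballP[e /= e0 xeE] : nbhs x E by exact: open_nbhs_nbhs.
  pose n := maxn (Num.truncn `|x|).+1 (Num.truncn e^-1).+1.
  have n1 : `|x| <= n%:R.
    rewrite (le_trans (ltW (truncnS_gt _)))// ler_nat leq_maxl//.
  have n2 : n.+1%:R^-1 < e.
    rewrite invf_plt ?posrE// (lt_le_trans (truncnS_gt _))// ler_nat.
    by rewrite (@leq_trans n)// leq_maxr.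
  exists n => //; split => //; split; apply: xeE; rewrite /ball/=.
    by rewrite opprB addrC subrK ger0_norm// ltW.
  by rewrite opprD addrA subrr sub0r normrN ger0_norm// ltW.
have ndK : nondecreasing_seq K.
  move=> n m nm; rewrite subsetEset => x [xn [xl xr]].
  have inm : m.+1%:R^-1 <= n.+1%:R^-1 :> R by rewrite lef_pV2 ?posrE// ler_nat.
  split; first by rewrite (le_trans xn)// ler_nat.
  split; apply: (iE _ _ xl xr).
    by rewrite lerB//= lerD2l (le_trans _ (ltW (nV n)))// oppr_le0 ltW.
  by rewrite !lerD2l inm andbT (le_trans _ (ltW (nV m)))// oppr_le0 ltW.
have -> : (\int[leb]_(x in E) (f x)%:E =
    limn (fun n => \int[leb]_(x in K n) (f x)%:E))%E.
  rewrite {1}UK; apply/esym/cvg_lim => //.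
  apply: ge0_nondecreasing_set_cvg_integral => //.
  - by move=> n; apply/measurable_EFinP; exact: measurable_funS mE (KE n) mf.
  - by move=> n x /KE Ex; rewrite lee_fin f0.
have Kle n : (\int[leb]_(x in K n) (f x)%:E <= (2 * B)%:E)%E.
  have [->|/set0P[x0 Kx0]] := eqVneq (K n) set0.
    by rewrite integral_set0 lee_fin mulr_ge0.
  have ubK : has_ubound (K n).
    by exists n%:R => x [xn _]; rewrite (le_trans (ler_norm _)).
  have lbK : has_lbound (K n).
    by exists (- n%:R) => x [xn _]; move: xn; rewrite ler_norml => /andP[].
  have hinf : has_inf (K n) by split => //; exists x0.
  have hsup : has_sup (K n) by split => //; exists x0.
  have Einf : E (inf (K n)).
    have [x Kx xlt] := inf_adherent (nV n) hinf.
    have px : inf (K n) <= x by exact: ge_inf.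
    have [_ [xl xr]] := Kx.
    apply: (iE _ _ xl (KE n _ Kx)); rewrite px andbT.
    by rewrite lerBlDr ltW.
  have Esup : E (sup (K n)).
    have [x Kx xlt] := sup_adherent (nV n) hsup.
    have px : x <= sup (K n) by exact: ub_le_sup.
    have [_ [xl xr]] := Kx.
    apply: (iE _ _ (KE n _ Kx) xr); rewrite px/=.
    by rewrite -lerBlDr ltW.
  have pq : inf (K n) <= sup (K n).
    by apply: (@le_trans _ _ x0); [exact: ge_inf|exact: ub_le_sup].
  have pqE x : inf (K n) <= x <= sup (K n) -> E x by exact: iE.
  have sE : `[inf (K n), sup (K n)] `<=` E.
    by move=> x /=; rewrite in_itv/= => /pqE.
  apply: (@le_trans _ _
      (\int[leb]_(x in `[inf (K n), sup (K n)]) (f x)%:E)%E).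
    apply: ge0_subset_integral => //.
    - exact: mK.
    - by apply/measurable_EFinP; exact: measurable_funS mE sE mf.
    - by move=> x /=; rewrite in_itv/= lee_fin => /pqE/f0.
    - by move=> x Kx /=; rewrite in_itv/= ge_inf//= ub_le_sup.
  rewrite (@integral_derivative_segment f F _ _ pq
    (fun x xpq => dF x (pqE x xpq)) (fun x xpq => cf x (pqE x xpq))).
  rewrite lee_fin (le_trans (ler_norm _))// (le_trans (ler_normB _ _))//.
  by rewrite mulr_natl mulr2n lerD// FB.
apply: lime_le; last by near=> n; exact: Kle.
apply: ereal_nondecreasing_is_cvgn.
apply: ge0_nondecreasing_set_nondecreasing_integral => //.
- by move=> n; apply/measurable_EFinP; exact: measurable_funS mE (KE n) mf.
- by move=> n x /KE Ex; rewrite lee_fin f0.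
Unshelve. all: by end_near.
Qed.

End FTC.

(** * The cosine transform of a quadratic window *)

(** The window 1 - (y/N)^2 is cut off at 0.  It vanishes at the end points of
    [-N, N], which makes its cosine transform decay quadratically, and a single
    polynomial describes it, so that an explicit primitive is available. *)
Definition welch (R : realType) (N y : R) : R := Num.max 0 (1 - (y / N) ^+ 2).

Section welch.
Context (R : realType).
Local Notation leb := (@lebesgue_measure R).
Implicit Types (N w y : R).

Lemma welch_ge0 N y : 0 <= welch N y.
Proof. by rewrite /welch le_max lexx. Qed.

Lemma welch_le1 N y : welch N y <= 1.
Proof. by rewrite /welch ge_max ler01 gerBl sqr_ge0. Qed.

Lemma continuous_welch N : continuous (welch N).
Proof.
move=> y; apply: (@continuous_max _ _ (fun=> 0) (fun y => 1 - (y / N) ^+ 2)).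
  exact: cvg_cst.
apply: cvgB; first exact: cvg_cst.
by apply: cvgM; apply: cvgM; [exact: cvg_id|exact: cvg_cst|exact: cvg_id|exact: cvg_cst].
Qed.

Lemma measurable_welch N : measurable_fun setT (welch N).
Proof. by apply: continuous_measurable_fun; exact: continuous_welch. Qed.

Lemma welch_in N y : 0 < N -> `|y| <= N -> welch N y = 1 - (y / N) ^+ 2.
Proof.
move=> N0 yN; apply/max_idPr; rewrite subr_ge0 -real_normK ?num_real//.
by rewrite expr_le1// normrM normfV (gtr0_norm N0) ler_pdivrMr// mul1r.
Qed.

Lemma welch_out N y : 0 < N -> N < `|y| -> welch N y = 0.
Proof.
move=> N0 yN; apply/max_idPl; rewrite subr_le0 -real_normK ?num_real//.
by rewrite expr_ge1// normrM normfV (gtr0_norm N0) ler_pdivlMr// mul1r ltW.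
Qed.

Lemma integral_welchM N (f : R -> R) : 0 < N ->
  \int[leb]_y (welch N y * f y) =
  \int[leb]_(y in `[- N, N]) ((1 - (y / N) ^+ 2) * f y).
Proof.
move=> N0; rewrite [RHS]Rintegral_mkcond; apply: eq_Rintegral => y _.
rewrite patchE; case: ifPn => [|/negP].
  by rewrite inE/= in_itv/= -ler_norml => yN; rewrite welch_in.
rewrite inE/= in_itv/= -ler_norml => /negP; rewrite -ltNge => yN.
by rewrite welch_out ?mul0r.
Qed.

Lemma integrable_welch N : 0 < N -> leb.-integrable setT (EFin \o welch N).
Proof.
move=> N0.
apply: (@le_integrable _ _ _ leb _ measurableT _
    (EFin \o (\1_(`[- N, N]%classic) : R -> R))).
- by apply/measurable_EFinP; exact: measurable_welch.
- move=> y _; rewrite lee_fin (ger0_norm (welch_ge0 _ _)) indicE.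
  case: (boolP (y \in _)) => /=; first by rewrite normr1 welch_le1.
  rewrite notin_setE/= in_itv/= -ler_norml => /negP; rewrite -ltNge => yN.
  by rewrite normr0 welch_out.
- exact: integrable_indic_itv.
Qed.

Lemma Rintegral_welch_le N : 0 < N -> \int[leb]_y welch N y <= 2 * N.
Proof.
move=> N0; rewrite -lee_fin /Rintegral fineK; last first.
  exact: (integrable_fin_num _ (integrable_welch N0)).
apply: (@le_trans _ _ (\int[leb]_y (\1_(`[- N, N]%classic) y)%:E)%E).
  apply: ge0_le_integral => //.
  - by move=> y _; rewrite lee_fin welch_ge0.
  - by apply/measurable_EFinP; exact: measurable_welch.
  - by apply/measurable_EFinP; exact: measurable_indic.
  move=> y _; rewrite lee_fin indicE.
  case: (boolP (y \in _)) => /=; first by rewrite welch_le1.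
  rewrite notin_setE/= in_itv/= -ler_norml => /negP; rewrite -ltNge => yN.
  by rewrite welch_out.
rewrite integral_indic//= setIT lebesgue_measure_itv/= lte_fin.
by rewrite ifT /= ?lee_fin ?opprK ?mulr_natl//; lra.
Qed.

Lemma welch_cos_primitive N w y : N != 0 -> w != 0 ->
  is_derive y 1 (fun y => (1 - (y / N) ^+ 2) * (sin (w * y) / w)
    - 2 / N ^+ 2 / w ^+ 2 * (y * cos (w * y))
    + 2 / N ^+ 2 / w ^+ 3 * sin (w * y))
  ((1 - (y / N) ^+ 2) * cos (w * y)).
Proof.
move=> N0 w0.
have scaleE (a b : R) : a *: (b : R^o) = a * b by [].
have dw : is_derive y 1 (fun y => w * y) w.
  by apply: is_derive_eq (is_deriveZ w (is_derive_id y 1)) _; rewrite scaleE mulr1.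
have ds : is_derive y 1 (fun y => sin (w * y)) (cos (w * y) * w).
  exact: is_derive1_comp (is_derive_sin _) dw.
have dc : is_derive y 1 (fun y => cos (w * y)) (- sin (w * y) * w).
  exact: is_derive1_comp (is_derive_cos _) dw.
have dp : is_derive y 1 (fun y => 1 - (y / N) ^+ 2) (- (2 * y / N ^+ 2)).
  have -> : (fun y => 1 - (y / N) ^+ 2) = cst 1 + (- (N ^- 2)) \*: (id ^+ 2).
    by apply/funext => z; rewrite !fctE/= scaleE expr_div_n; ring.
  apply: is_derive_eq.
  by rewrite !scaleE/=; field.
have -> : (fun y => (1 - (y / N) ^+ 2) * (sin (w * y) / w)
    - 2 / N ^+ 2 / w ^+ 2 * (y * cos (w * y))
    + 2 / N ^+ 2 / w ^+ 3 * sin (w * y)) =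
  (fun y => 1 - (y / N) ^+ 2) * (w^-1 \*: (fun y => sin (w * y)))
  - (2 / N ^+ 2 / w ^+ 2) \*: (id * (fun y => cos (w * y)))
  + (2 / N ^+ 2 / w ^+ 3) \*: (fun y => sin (w * y)).
  by apply/funext => z; rewrite !fctE/= !scaleE [w^-1 * _]mulrC.
apply: is_derive_eq.
by rewrite !scaleE/= !scaleE; field; rewrite N0.
Qed.

(** For N|w| <= 2 the window has mass at most 2N; otherwise two integrations by
    parts, hidden in the explicit primitive, gain (N w)^(-2). *)
Lemma welch_cos_bound N w : 0 < N ->
  `|\int[leb]_y (welch N y * cos (w * y))| <= 10 * N / (1 + (N * w) ^+ 2).
Proof.
move=> N0.
have den0 : 0 < 1 + (N * w) ^+ 2 by rewrite ltr_pwDl// sqr_ge0.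
have mc : measurable_fun setT (fun y => cos (w * y)).
  apply: continuous_measurable_fun => y.
  apply: continuous_comp; last exact: continuous_cos.
  by apply: cvgM; [exact: cvg_cst|exact: cvg_id].
have iwc : leb.-integrable setT (EFin \o (fun y => welch N y * cos (w * y))).
  apply: (@le_integrable _ _ _ leb _ measurableT _ (EFin \o welch N)).
  - by apply/measurable_EFinP; apply: measurable_funM => //; exact: measurable_welch.
  - move=> y _; rewrite lee_fin normrM ler_piMr// ?cos_max//.
  - exact: integrable_welch.
have triv : `|\int[leb]_y (welch N y * cos (w * y))| <= 2 * N.
  apply: (le_trans (le_normr_Rintegral _ iwc)) => //.
  apply: le_trans (Rintegral_welch_le N0).
  apply: le_Rintegral => //; first exact: (integrable_norm iwc).
    exact: integrable_welch.
  by move=> y _; rewrite normrM (ger0_norm (welch_ge0 _ _)) ler_piMr ?welch_ge0 ?cos_max.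
have [x4|x4] := leP ((N * w) ^+ 2) 4.
  apply: (le_trans triv); rewrite ler_pdivlMr//; nra.
have w0 : w != 0.
  by apply: contraTneq x4 => ->; rewrite mulr0 expr0n/= -leNgt.
have NN : - N <= N by lra.
rewrite integral_welchM//.
have -> : \int[leb]_(y in `[(- N), N]) ((1 - (y / N) ^+ 2) * cos (w * y)) =
   - 4 / (N * w ^+ 2) * cos (w * N) + 4 / (N ^+ 2 * w ^+ 3) * sin (w * N).
  rewrite /Rintegral (@integral_derivative_segment _ _ _ _ _ NN
    (fun x _ => welch_cos_primitive x (lt0r_neq0 N0) w0)).
    by rewrite /= !mulrN cosN sinN; field; rewrite w0 lt0r_neq0.
  move=> x _; apply: cvgM.
    apply: cvgB; first exact: cvg_cst.
    by apply: cvgM; apply: cvgM; [exact: cvg_id|exact: cvg_cst|exact: cvg_id|exact: cvg_cst].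
  apply: continuous_comp; last exact: continuous_cos.
  by apply: cvgM; [exact: cvg_cst|exact: cvg_id].
set X := N * w in x4 *.
have X0 : X != 0 by rewrite mulf_neq0// lt0r_neq0.
have X2 : 2 < `|X|.
  by rewrite -(ltr_pXn2r (n := 2))// ?nnegrE// real_normK ?num_real//; lra.
have -> : - 4 / (N * w ^+ 2) * cos (w * N) + 4 / (N ^+ 2 * w ^+ 3) * sin (w * N) =
    N / X ^+ 2 * (- 4 * cos (w * N) + 4 * sin (w * N) / X).
  by rewrite /X; field; rewrite w0 lt0r_neq0.
rewrite normrM ger0_norm; last by rewrite divr_ge0 ?sqr_ge0// ltW.
have sX : `|sin (w * N) / X| <= 2^-1.
  rewrite normrM normfV ler_pdivrMr; last by rewrite (lt_trans _ X2).
  by rewrite (le_trans (sin_max _))//; lra.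
have c1 := cos_max (w * N).
have : `|- 4 * cos (w * N) + 4 * sin (w * N) / X| <= 6.
  rewrite -mulrA; move: sX c1; rewrite !ler_norml => /andP[? ?] /andP[? ?].
  by apply/andP; split; lra.
move=> h6; apply: (@le_trans _ _ (N / X ^+ 2 * 6)).
  by rewrite ler_wpM2l// divr_ge0 ?sqr_ge0// ltW.
have XX : 0 < X ^+ 2 by exact: lt_trans x4.
rewrite mulrAC ler_pdivrMr// mulrAC ler_pdivlMr//.
nra.
Qed.

End welch.

(** * Integrals of tensor products *)

Lemma integrable_scale d (T : measurableType d) (R : realType)
    (mu : {measure set T -> \bar R}) (r : R) (f : T -> R) :
  mu.-integrable setT (EFin \o f) ->
  mu.-integrable setT (EFin \o (fun x => r * f x)).
Proof.
move=> fi; rewrite (_ : EFin \o _ = (fun x => r%:E * (EFin \o f) x)%E)//.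
exact: integrableZl.
Qed.

Lemma integrable_add d (T : measurableType d) (R : realType)
    (mu : {measure set T -> \bar R}) (f g : T -> R) :
  mu.-integrable setT (EFin \o f) -> mu.-integrable setT (EFin \o g) ->
  mu.-integrable setT (EFin \o (fun x => f x + g x)).
Proof.
move=> fi gi; rewrite (_ : EFin \o _ = (EFin \o f) \+ (EFin \o g))%E.
  exact: integrableD.
by apply/funext => x /=; rewrite EFinD.
Qed.

Section tensor.
Context (R : realType).
Local Notation leb := (@lebesgue_measure R).
Local Notation mu2 := (@lebesgue2 R).

Lemma Rintegral_tensor (a b : R -> R) :
  leb.-integrable setT (EFin \o a) -> leb.-integrable setT (EFin \o b) ->
  \int[mu2]_z (a z.1 * b z.2) = \int[leb]_x a x * \int[leb]_x b x.
Proof.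
move=> ia ib.
have /integrableP[/measurable_EFinP ma _] := ia.
have /integrableP[/measurable_EFinP mb _] := ib.
have mf : measurable_fun setT (fun z : R * R => a z.1 * b z.2).
  by apply: measurable_funM; exact: measurableT_comp.
have [|-> _] := @Rintegral_prodE _ _ _ _ R leb leb
  (fun z : R * R => a z.1 * b z.2) (fun x => `|a x|) (fun x => `|b x|) mf
  (integrable_norm ia) (integrable_norm ib).
  by move=> x y; rewrite normrM.
rewrite -RintegralZr//; apply: eq_Rintegral => x _.
by rewrite -RintegralZl.
Qed.

Lemma ge0_integral_lebesgue2 (f : R * R -> \bar R) :
  measurable_fun setT f -> (forall z, 0 <= f z)%E ->
  (\int[mu2]_z f z = \int[leb]_x \int[leb]_y f (x, y))%E.
Proof. by move=> mf f0; exact: (@fubini_tonelli1 _ _ _ _ R leb leb f mf f0). Qed.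

Lemma ge0_integral_tensor (a b : R -> R) :
  measurable_fun setT a -> measurable_fun setT b ->
  (forall x, 0 <= a x) -> (forall x, 0 <= b x) ->
  (\int[mu2]_z (a z.1 * b z.2)%:E =
    \int[leb]_x (a x)%:E * \int[leb]_x (b x)%:E)%E.
Proof.
move=> ma mb a0 b0.
have mf' : measurable_fun setT (fun z : R * R => a z.1 * b z.2).
  by apply: measurable_funM; exact: measurableT_comp.
have mf : measurable_fun setT (fun z : R * R => (a z.1 * b z.2)%:E).
  exact/measurable_EFinP.
have f0 (z : R * R) : (0 <= (a z.1 * b z.2)%:E)%E by rewrite lee_fin mulr_ge0.
rewrite ge0_integral_lebesgue2//=.
have mEb : measurable_fun setT (fun x => (b x)%:E) by exact/measurable_EFinP.
have b0' x : setT x -> (0 <= (b x)%:E)%E by rewrite lee_fin.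
transitivity (\int[leb]_x ((a x)%:E * \int[leb]_y (b y)%:E))%E.
  apply: eq_integral => x _; rewrite -ge0_integralZl//.
  by rewrite lee_fin.
rewrite ge0_integralZr//.
- exact/measurable_EFinP.
- by move=> x _; rewrite lee_fin.
- by apply: integral_ge0 => x _; rewrite lee_fin.
Qed.
End tensor.

(** * Kernels of the sine and cosine transforms *)

Definition trig (R : realType) (p : bool) (u : R) : R :=
  if p then sin u else cos u.

(** The two summands come from the difference and the sum of frequencies in
    [trigM]; the sine and the cosine need the same bound. *)
Definition trig_kernel (R : realType) (N s : R) (z : R * R) : R :=
  5 * N / (1 + (N * (s * (z.1 - z.2))) ^+ 2) +
  5 * N / (1 + (N * (s * (z.1 + z.2))) ^+ 2).

(** Real and imaginary parts of exp(i s y.x) are sums of such products, which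
    separate the two coordinates. *)
Definition trig_phase (R : realType) (p q : bool) (s : R)
    (z : (R * R) * (R * R)) : R :=
  trig p (s * (z.1.1 * z.2.1)) * trig q (s * (z.1.2 * z.2.2)).

Definition trig_transform (R : realType) (p q : bool) (s : R) (g : R * R -> R)
    (y : R * R) : R :=
  \int[@lebesgue2 R]_x (trig_phase p q s (y, x) * g x).

Section trig.
Context (R : realType).
Local Notation leb := (@lebesgue_measure R).
Local Notation mu2 := (@lebesgue2 R).
Implicit Types (p q : bool) (N s u v : R).

Lemma trig_le1 p u : `|trig p u| <= 1.
Proof. by case: p; rewrite ?sin_max ?cos_max. Qed.

Lemma measurable_trig p : measurable_fun setT (@trig R p).
Proof.
case: p; apply: continuous_measurable_fun => x.
  exact: continuous_sin.
exact: continuous_cos.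
Qed.

Lemma trigM p u v : trig p u * trig p v =
  2^-1 * (cos (u - v) + (if p then -1 else 1) * cos (u + v)).
Proof.
by rewrite /trig cosB cosD; case: p; field.
Qed.

Lemma measurable_trig_phase p q s : measurable_fun setT (@trig_phase R p q s).
Proof.
apply: measurable_funM; apply: (measurableT_comp (@measurable_trig _));
  apply: measurable_funM => //; apply: measurable_funM;
  by do 2 apply: measurableT_comp => //.
Qed.

Lemma trig_phase_le1 p q s z : `|@trig_phase R p q s z| <= 1.
Proof. by rewrite normrM mulr_ile1// trig_le1. Qed.

Lemma trig_kernel_ge0 N s z : 0 < N -> 0 <= trig_kernel N s z.
Proof.
move=> N0; rewrite addr_ge0// divr_ge0 ?mulr_ge0// ?(ltW N0)//;
  by rewrite addr_ge0// sqr_ge0.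
Qed.

Lemma trig_kernel_sym N s x y : trig_kernel N s (x, y) = trig_kernel N s (y, x).
Proof.
rewrite /trig_kernel/= (addrC y x) -(opprB y x) !mulrN sqrrN//.
Qed.

Lemma measurable_oneDsqrV d (T : measurableType d) (f : T -> R) :
  measurable_fun setT f ->
  measurable_fun setT (fun x => (1 + f x ^+ 2)^-1).
Proof.
move=> mf.
have mV : measurable_fun setT (fun r : R => (1 + r ^+ 2)^-1).
  by apply: continuous_measurable_fun; exact: continuous_oneDsqrV.
exact: (measurableT_comp mV).
Qed.

Lemma measurable_trig_kernel N s : measurable_fun setT (@trig_kernel R N s).
Proof.
apply: measurable_funD; apply: measurable_funM => //;
  apply: measurable_oneDsqrV; do 2 apply: measurable_funM => //.
  exact: measurable_funB.
exact: measurable_funD.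
Qed.

Lemma trig_kernel_bound p N s x y : 0 < N ->
  `|\int[leb]_t (welch N t * (trig p (s * (t * x)) * trig p (s * (t * y))))|
    <= trig_kernel N s (x, y).
Proof.
move=> N0.
have iw w : leb.-integrable setT (EFin \o (fun t => welch N t * cos (w * t))).
  apply: (@le_integrable _ _ _ leb _ measurableT _ (EFin \o welch N)).
  - apply/measurable_EFinP; apply: measurable_funM; first exact: measurable_welch.
    apply: (measurableT_comp (@measurable_trig false)); exact: measurable_funM.
  - by move=> t _; rewrite lee_fin normrM ler_piMr// cos_max.
  - exact: integrable_welch.
have iZ r w : leb.-integrable setT (EFin \o (fun t => r * (welch N t * cos (w * t)))).
  exact: integrable_scale.
pose e : R := if p then -1 else 1.
have -> : \int[leb]_t (welch N t * (trig p (s * (t * x)) * trig p (s * (t * y)))) =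
    2^-1 * \int[leb]_t (welch N t * cos ((s * (x - y)) * t)) +
    e / 2 * \int[leb]_t (welch N t * cos ((s * (x + y)) * t)).
  rewrite -!RintegralZl// -RintegralD//; apply: eq_Rintegral => t _.
  rewrite trigM -/e -[X in cos X + _]/(s * (t * x) - s * (t * y)).
  rewrite (_ : s * (t * x) - s * (t * y) = s * (x - y) * t); last by ring.
  rewrite (_ : s * (t * x) + s * (t * y) = s * (x + y) * t); last by ring.
  by field.
have e1 : `|e| = 1 by rewrite /e; case: (p); rewrite ?normrN normr1.
rewrite (le_trans (ler_normD _ _))// lerD//.
  rewrite normrM gtr0_norm// ler_pdivrMl// (le_trans (welch_cos_bound _ N0))//.
  rewrite /=; lra.
rewrite normrM (_ : `|e / 2| = 2^-1); last first.
  by rewrite normrM e1 mul1r gtr0_norm// invr_gt0.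
rewrite ler_pdivrMl//.
by rewrite (le_trans (welch_cos_bound _ N0))//=; lra.
Qed.

(** The primitive is an arctangent; it oscillates by less than a constant over
    s, uniformly in N and r. *)
Lemma integral_oneDsqrV_affine N s r : 0 < N -> 0 < s ->
  (\int[leb]_y (5 * N / (1 + (N * (s * (y + r))) ^+ 2))%:E <= (20 / s)%:E)%E.
Proof.
move=> N0 s0.
have d0 (y : R) : 0 < 1 + (N * (s * (y + r))) ^+ 2 by rewrite ltr_pwDl// sqr_ge0.
have cl : continuous (fun y : R => N * (s * (y + r))).
  move=> y; apply: cvgM; first exact: cvg_cst.
  apply: cvgM; first exact: cvg_cst.
  by apply: cvgD; [exact: cvg_id|exact: cvg_cst].
have dl (y : R) : is_derive y 1 (fun y : R => N * (s * (y + r))) (N * s).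
  have -> : (fun y : R => N * (s * (y + r))) = (N * s) \*: (id + cst r).
    by apply/funext => z; rewrite !fctE/= mulrA.
  apply: is_derive_eq.
  by rewrite addr0 -[LHS]/(_ * _) mulr1.
have dF (y : R) : is_derive y 1 (fun y => 5 / s * atan (N * (s * (y + r))))
    (5 * N / (1 + (N * (s * (y + r))) ^+ 2)).
  have da := @is_derive1_comp R _ (fun y => N * (s * (y + r))) y _ _
    (is_derive1_atan (N * (s * (y + r)))) (dl y).
  apply: is_derive_eq (is_deriveZ (5 / s) da) _.
  rewrite -[LHS]/(_ * _); field.
  by rewrite lt0r_neq0// lt0r_neq0.
have := @integral_derivative_le R _ _ setT (10 / s) _ _ (fun x _ => dF x).
rewrite (_ : 2 * (10 / s) = 20 / s); last by field; rewrite lt0r_neq0.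
apply => //.
- exact: openT.
- move=> y _; apply: cvgM; first exact: cvg_cst.
  exact: (continuous_comp (cl y) (@continuous_oneDsqrV _ _)).
- by move=> y _; rewrite divr_ge0 ?mulr_ge0// ltW.
- by rewrite divr_ge0// ltW.
move=> y _; rewrite normrM ger0_norm; last by rewrite divr_ge0// ltW.
rewrite mulrAC ler_pM2r ?invr_gt0// (_ : 10 = 5 * 2); last by ring.
rewrite ler_pM2l// ler_norml.
set z := (N * _).
have := atan_gtNpi2 z; have := atan_ltpi2 z; have := @pihalf_lt2 R.
by move=> ? ? ?; apply/andP; split; lra.
Qed.

Lemma integral_trig_kernel N s x : 0 < N -> 0 < s ->
  (\int[leb]_y (trig_kernel N s (x, y))%:E <= (40 / s)%:E)%E.
Proof.
move=> N0 s0.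
have mV r : measurable_fun setT (fun y : R => 5 * N / (1 + (N * (s * (y + r))) ^+ 2)).
  apply: measurable_funM => //; apply: measurable_oneDsqrV.
  by do 2 apply: measurable_funM => //; exact: measurable_funD.
have V0 r y : (0 <= (5 * N / (1 + (N * (s * (y + r))) ^+ 2))%:E)%E.
  by rewrite lee_fin divr_ge0 ?mulr_ge0 ?addr_ge0 ?sqr_ge0// ltW.
under eq_integral => y _.
  rewrite /trig_kernel/= -(opprB y x) !mulrN sqrrN (addrC x y) EFinD.
  over.
rewrite ge0_integralD//; try (by apply/measurable_EFinP; exact: mV).
rewrite (_ : 40 / s = 20 / s + 20 / s); last by field; rewrite lt0r_neq0.
by rewrite EFinD leeD// integral_oneDsqrV_affine.
Qed.

End trig.

(** * The real transforms are bounded on L^2 *)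

Section Bessel.
Context (R : realType).
Local Notation leb := (@lebesgue_measure R).
Local Notation mu2 := (@lebesgue2 R).
Implicit Types (p q : bool) (N s : R).

Lemma measurable_trig_transform p q s (g : R * R -> R) :
  measurable_fun setT g -> measurable_fun setT (trig_transform p q s g).
Proof.
move=> mg; apply: (@measurable_parametric_Rintegral _ _ _ _ _ mu2
  (fun z => trig_phase p q s z * g z.2)).
apply: measurable_funM; first exact: measurable_trig_phase.
exact: measurableT_comp.
Qed.

Lemma trig_transform_windowed p q s N (g : R * R -> R) : 0 < s -> 0 < N ->
  mu2.-integrable setT (EFin \o g) ->
  (\int[mu2]_y ((welch N y.1 * welch N y.2) * trig_transform p q s g y ^+ 2)%:E
    <= (2 * (40 / s) ^+ 2)%:E * \int[mu2]_x (g x ^+ 2)%:E)%E.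
Proof.
move=> s0 N0 ig.
pose M (z : (R * R) * (R * R)) : R :=
  trig_kernel N s (z.1.1, z.2.1) * trig_kernel N s (z.1.2, z.2.2).
have mker x : measurable_fun setT (fun y : R => trig_kernel N s (x, y)).
  by apply: (measurableT_comp (measurable_trig_kernel N s)); exact: measurable_fun_pair.
have intM (x : R * R) : (\int[mu2]_y (M (x, y))%:E <= ((40 / s) ^+ 2)%:E)%E.
  rewrite [leLHS](@ge0_integral_tensor _ (fun y => trig_kernel N s (x.1, y))
    (fun y => trig_kernel N s (x.2, y)))//; try by move=> y; exact: trig_kernel_ge0.
  rewrite expr2 EFinM; apply: lee_pmul; rewrite ?integral_trig_kernel//;
    by apply: integral_ge0 => y _; rewrite lee_fin trig_kernel_ge0.
apply: (@TTstar_bound _ _ _ _ R mu2 mu2 (trig_phase p q s)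
  (fun y => welch N y.1 * welch N y.2) g M) => //.
- exact: measurable_trig_phase.
- by move=> z; exact: trig_phase_le1.
- by move=> y; rewrite mulr_ge0// welch_ge0.
- apply: (@integrable_tensor _ _ _ _ R leb leb _ (welch N) (welch N)).
  + apply: measurable_funM; apply: measurableT_comp => //; exact: measurable_welch.
  + exact: integrable_welch.
  + exact: integrable_welch.
  + by move=> x y; rewrite ger0_norm// mulr_ge0// welch_ge0.
- apply: measurable_funM; apply: (measurableT_comp (measurable_trig_kernel N s));
    by apply: measurable_fun_pair; do 2 apply: measurableT_comp => //.
- move=> x x'; rewrite /M/=.
  pose a r t t' (y : R) := welch N y * (trig r (s * (y * t)) * trig r (s * (y * t'))).
  have ia r t t' : leb.-integrable setT (EFin \o a r t t').
    apply: (@le_integrable _ _ _ leb _ measurableT _ (EFin \o welch N)).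
    + apply/measurable_EFinP; apply: measurable_funM; first exact: measurable_welch.
      by apply: measurable_funM; apply: (measurableT_comp (@measurable_trig _ r));
        do 2 apply: measurable_funM => //.
    + move=> y _; rewrite lee_fin normrM ler_piMr// normrM.
      by rewrite mulr_ile1// trig_le1.
    + exact: integrable_welch.
  rewrite (_ : (\int[mu2]_y _) = \int[leb]_y a p x.1 x'.1 y * \int[leb]_y a q x.2 x'.2 y).
    by rewrite normrM ler_pM// trig_kernel_bound.
  rewrite -Rintegral_tensor//; apply: eq_Rintegral => y _.
  by rewrite /a /trig_phase/=; ring.
- move=> x'; rewrite (le_trans _ (intM x'))// le_eqVlt; apply/orP; left; apply/eqP.
  by apply: eq_integral => x _; rewrite /M/= trig_kernel_sym (trig_kernel_sym _ _ x.2).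
Qed.

(** On the square of half side N/2 the window is at least 3/4 in each
    coordinate, so the windowed estimate controls the integral over that square
    up to a factor 2; the squares exhaust the plane.  The constant is
    2 * (2 * (40 / s) ^ 2). *)
Lemma trig_transform_L2 p q s (g : R * R -> R) : 0 < s ->
  mu2.-integrable setT (EFin \o g) ->
  (\int[mu2]_y (trig_transform p q s g y ^+ 2)%:E
    <= ((80 / s) ^+ 2)%:E * \int[mu2]_x (g x ^+ 2)%:E)%E.
Proof.
move=> s0 ig.
have /integrableP[/measurable_EFinP mg _] := ig.
have mT2 : measurable_fun setT (fun y => trig_transform p q s g y ^+ 2).
  by apply: measurable_funX; exact: measurable_trig_transform.
(* n.+1 rather than n keeps the side positive. *)
pose S n : set (R * R) := `[- (n.+1%:R / 2), n.+1%:R / 2]%classic `*`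
                          `[- (n.+1%:R / 2), n.+1%:R / 2]%classic.
have mS n : measurable (S n) by apply: measurableX => //; exact: measurable_itv.
have ndS : nondecreasing_seq S.
  move=> n m nm; rewrite subsetEset => -[x y]; rewrite /S/= !in_itv/= -!ler_norml.
  have h : n.+1%:R / 2 <= m.+1%:R / 2 :> R by rewrite ler_pM2r// ler_nat.
  by move=> [x1 y1]; split; [exact: le_trans h|exact: le_trans h].
have US : setT = \bigcup_n S n.
  apply/esym; rewrite -subTset => -[x y] _.
  pose n := Num.truncn (2 * (`|x| + `|y|)).
  have nb : (`|x| + `|y|) <= n.+1%:R / 2.
    by rewrite ler_pdivlMr// mulrC ltW// truncnS_gt.
  exists n => //; rewrite /S/= !in_itv/= -!ler_norml.
  by have := normr_ge0 x; have := normr_ge0 y; split; lra.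
have -> : (\int[mu2]_y (trig_transform p q s g y ^+ 2)%:E =
    limn (fun n => \int[mu2]_(y in S n) (trig_transform p q s g y ^+ 2)%:E))%E.
  rewrite {1}US; apply/esym/cvg_lim => //.
  apply: ge0_nondecreasing_set_cvg_integral => //.
  - by move=> n; apply/measurable_EFinP; exact: measurable_funTS.
  - by move=> n x _; rewrite lee_fin sqr_ge0.
apply: lime_le.
  apply: ereal_nondecreasing_is_cvgn.
  apply: ge0_nondecreasing_set_nondecreasing_integral => //.
  - by move=> n; apply/measurable_EFinP; exact: measurable_funTS.
  - by move=> n x _; rewrite lee_fin sqr_ge0.
near=> n.
have N0 : 0 < n.+1%:R :> R by [].
have mw : measurable_fun setT (fun y : R * R => welch n.+1%:R y.1 * welch n.+1%:R y.2).
  by apply: measurable_funM; apply: measurableT_comp => //; exact: measurable_welch.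
have k0 y : 0 <= (welch n.+1%:R y.1 * welch n.+1%:R y.2) *
    trig_transform p q s g y ^+ 2.
  by apply: mulr_ge0; rewrite ?sqr_ge0// mulr_ge0// welch_ge0.
apply: (@le_trans _ _ (2%:E * \int[mu2]_y
  ((welch n.+1%:R y.1 * welch n.+1%:R y.2) * trig_transform p q s g y ^+ 2)%:E)%E).
  rewrite -ge0_integralZl//; last 2 first.
  - by apply/measurable_EFinP; exact: measurable_funM.
  - by move=> y _; rewrite lee_fin; exact: k0.
  apply: (@le_trans _ _ (\int[mu2]_(y in S n) (2%:E *
    ((welch n.+1%:R y.1 * welch n.+1%:R y.2) * trig_transform p q s g y ^+ 2)%:E))%E).
    apply: ge0_le_integral => //.
    - exact: mS.
    - by move=> y _; rewrite lee_fin sqr_ge0.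
    - by apply/measurable_EFinP; exact: measurable_funTS.
    - apply/measurable_EFinP; apply: measurable_funTS.
      by apply: measurable_funM => //; exact: measurable_funM.
    move=> y [/=]; rewrite !in_itv/= -!ler_norml => y1 y2.
    have w34 (r : R) : `|r| <= n.+1%:R / 2 -> 3 / 4 <= welch n.+1%:R r.
      move=> rn; rewrite welch_in//; last by rewrite (le_trans rn)// ler_pdivrMr// ler_peMr//; lra.
      have : `|r / n.+1%:R| <= 2^-1.
        by rewrite normrM normfV (gtr0_norm N0) ler_pdivrMr// mulrC.
      set u := r / _ => u2; rewrite lerBrDr -lerBrDl.
      rewrite -(real_normK (num_real u)) (le_trans (_ : _ <= 2^-1 ^+ 2))//; last by lra.
      by rewrite lerXn2r ?nnegrE.
    rewrite -EFinM lee_fin mulrA ler_peMl ?sqr_ge0//.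
    by have := w34 _ y1; have := w34 _ y2; nra.
  apply: ge0_subset_integral => //.
  - exact: mS.
  - apply/measurable_EFinP.
    by apply: measurable_funM => //; exact: measurable_funM.
  - by move=> y _; rewrite mule_ge0// lee_fin; exact: k0.
apply: (le_trans (lee_wpmul2l _ (trig_transform_windowed p q s0 N0 ig))) => //.
rewrite muleA -EFinM (_ : 2 * (2 * (40 / s) ^+ 2) = (80 / s) ^+ 2)//.
by field; rewrite lt0r_neq0.
Unshelve. all: by end_near.
Qed.

End Bessel.

(** * Complex-valued functions *)

(** Componentwise, like the integral [cintegral2]. *)
Definition cmeasurable d (T : measurableType d) (R : realType) (F : T -> R[i]) :=
  measurable_fun setT (fun x => complex.Re (F x)) /\
  measurable_fun setT (fun x => complex.Im (F x)).

Definition cintegrable (R : realType) (F : R * R -> R[i]) :=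
  (@lebesgue2 R).-integrable setT (EFin \o (fun x => complex.Re (F x))) /\
  (@lebesgue2 R).-integrable setT (EFin \o (fun x => complex.Im (F x))).

Section complex_functions.
Context (R : realType).
Implicit Types z w : R[i].

Lemma Re_mulc z w :
  complex.Re (z * w) = complex.Re z * complex.Re w - complex.Im z * complex.Im w.
Proof. by case: z => a b; case: w => c d. Qed.

Lemma Im_mulc z w :
  complex.Im (z * w) = complex.Re z * complex.Im w + complex.Im z * complex.Re w.
Proof. by case: z => a b; case: w => c d. Qed.

Lemma cabs_sqr z : cabs z ^+ 2 = complex.Re z ^+ 2 + complex.Im z ^+ 2.
Proof. by case: z => a b; rewrite /cabs/= sqr_sqrtr// addr_ge0// sqr_ge0. Qed.

Lemma cabs_ge0 z : 0 <= cabs z.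
Proof. by case: z => a b; exact: sqrtr_ge0. Qed.

Lemma cabsM z w : cabs (z * w) = cabs z * cabs w.
Proof. exact: ComplexField.Normc.normcM. Qed.

Lemma cabs_real (r : R) : cabs r%:C = `|r|.
Proof. by rewrite /cabs/= expr0n/= addr0 sqrtr_sqr. Qed.

Lemma cabs_expi (u : R) : cabs (expi u) = 1.
Proof. by rewrite /cabs/= cos2Dsin2 sqrtr1. Qed.

Lemma normr_Re_le z : `|complex.Re z| <= cabs z.
Proof.
by case: z => a b; rewrite /cabs/= -sqrtr_sqr ler_wsqrtr// lerDl sqr_ge0.
Qed.

Lemma normr_Im_le z : `|complex.Im z| <= cabs z.
Proof.
by case: z => a b; rewrite /cabs/= -sqrtr_sqr ler_wsqrtr// lerDr sqr_ge0.
Qed.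

Lemma cabs_le z : cabs z <= `|complex.Re z| + `|complex.Im z|.
Proof.
rewrite -(@ler_pXn2r _ 2)// ?nnegrE ?cabs_ge0// ?addr_ge0// cabs_sqr sqrrD.
by rewrite !real_normK ?num_real// lerD2r lerDl mulrn_wge0// mulr_ge0.
Qed.

Lemma expiD (u v : R) : expi (u + v) = expi u * expi v.
Proof.
apply/eqP; rewrite eq_complex Re_mulc Im_mulc/= cosD sinD eqxx/=.
by rewrite addrC [in _ + _ * cos _]mulrC [X in _ == X]addrC [X in X == _]addrC.
Qed.

Context d (T : measurableType d).
Implicit Types F G : T -> R[i].

Lemma cmeasurableM F G : cmeasurable F -> cmeasurable G ->
  cmeasurable (fun x => F x * G x).
Proof.
move=> [F1 F2] [G1 G2]; split.
  under eq_fun do rewrite Re_mulc.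
  by apply: measurable_funB; exact: measurable_funM.
under eq_fun do rewrite Im_mulc.
by apply: measurable_funD; exact: measurable_funM.
Qed.

Lemma cmeasurable_expi (u : T -> R) : measurable_fun setT u ->
  cmeasurable (fun x => expi (u x)).
Proof.
by move=> mu; split; [exact: (measurableT_comp (@measurable_trig R false))|
  exact: (measurableT_comp (@measurable_trig R true))].
Qed.

Lemma cmeasurable_real (u : T -> R) : measurable_fun setT u ->
  cmeasurable (fun x => (u x)%:C).
Proof. by move=> mu; split. Qed.

Lemma cmeasurable_cst z : cmeasurable (fun _ : T => z).
Proof. by split. Qed.

Lemma measurable_cabs F : cmeasurable F ->
  measurable_fun setT (fun x => cabs (F x)).
Proof.
move=> [F1 F2]; have -> : (fun x => cabs (F x)) =
    (@Num.sqrt R) \o (fun x => complex.Re (F x) ^+ 2 + complex.Im (F x) ^+ 2).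
  by apply/funext => x /=; rewrite -cabs_sqr sqrtr_sqr ger0_norm// cabs_ge0.
apply: measurableT_comp; last by apply: measurable_funD; exact: measurable_funX.
by apply: continuous_measurable_fun; exact: sqrt_continuous.
Qed.

Lemma cmeasurable_comp d' (S : measurableType d') (phi : S -> T) F :
  measurable_fun setT phi -> cmeasurable F -> cmeasurable (fun x => F (phi x)).
Proof.
by move=> mphi [F1 F2]; split; [exact: (measurableT_comp F1)|
  exact: (measurableT_comp F2)].
Qed.

End complex_functions.

Section complex_integrals.
Context (R : realType).
Local Notation mu2 := (@lebesgue2 R).
Implicit Types F G : R * R -> R[i].

Lemma cintegrable_measurable F : cintegrable F -> cmeasurable F.
Proof.
by move=> [/integrableP[/measurable_EFinP ? _] /integrableP[/measurable_EFinP ? _]].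
Qed.

Lemma cintegrableP F : cmeasurable F ->
  cintegrable F <-> mu2.-integrable setT (EFin \o (fun x => cabs (F x))).
Proof.
move=> mF; have [F1 F2] := mF; have mc := measurable_cabs mF; split.
  move=> [i1 i2].
  apply: (@le_integrable _ _ _ mu2 _ measurableT _
    ((EFin \o (fun x => `|complex.Re (F x)|%R)) \+
     (EFin \o (fun x => `|complex.Im (F x)|%R)))%E).
  - exact/measurable_EFinP.
  - move=> x _; rewrite /= lee_fin ger0_norm ?cabs_ge0//.
    by rewrite (le_trans (cabs_le _))// ler_norm.
  - by apply: integrableD => //; exact: integrable_norm.
move=> ic; split; apply: (le_integrable measurableT _ _ ic).
- exact/measurable_EFinP.
- by move=> x _; rewrite lee_fin (ger0_norm (cabs_ge0 _)) normr_Re_le.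
- exact/measurable_EFinP.
- by move=> x _; rewrite lee_fin (ger0_norm (cabs_ge0 _)) normr_Im_le.
Qed.

Lemma cintegrable_dominated F (a : R * R -> R) : cmeasurable F ->
  mu2.-integrable setT (EFin \o a) -> (forall x, cabs (F x) <= a x) ->
  cintegrable F.
Proof.
move=> mF ia Fa; apply/cintegrableP => //.
apply: (le_integrable measurableT _ _ ia).
  by apply/measurable_EFinP; exact: measurable_cabs.
by move=> x _; rewrite lee_fin (ger0_norm (cabs_ge0 _)) (le_trans (Fa x))// ler_norm.
Qed.

Lemma cintegrable_phase F (u : R * R -> R) : cintegrable F ->
  measurable_fun setT u -> cintegrable (fun x => F x * expi (u x)).
Proof.
move=> iF mu; have mF := cintegrable_measurable iF.
apply: (@cintegrable_dominated _ (fun x => cabs (F x))).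
- by apply: cmeasurableM => //; exact: cmeasurable_expi.
- exact/cintegrableP.
- by move=> x; rewrite cabsM cabs_expi mulr1.
Qed.

Lemma cintegral2Zl (c : R[i]) F : cintegrable F ->
  cintegral2 (fun x => c * F x) = c * cintegral2 F.
Proof.
move=> [i1 i2]; apply/eqP; rewrite eq_complex Re_mulc Im_mulc/=.
apply/andP; split; apply/eqP; rewrite -!RintegralZl//.
  rewrite -RintegralB//; try exact: integrable_scale.
  by apply: eq_Rintegral => x _; rewrite Re_mulc.
rewrite -RintegralD//; try exact: integrable_scale.
by apply: eq_Rintegral => x _; rewrite Im_mulc.
Qed.

Lemma cintegral2_exchange (H : (R * R) * (R * R) -> R[i]) (a b : R * R -> R) :
  cmeasurable H ->
  mu2.-integrable setT (EFin \o a) -> mu2.-integrable setT (EFin \o b) ->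
  (forall x y, cabs (H (x, y)) <= a x * b y) ->
  cintegral2 (fun x => cintegral2 (fun y => H (x, y))) =
  cintegral2 (fun y => cintegral2 (fun x => H (x, y))).
Proof.
move=> [H1 H2] ia ib Hab; rewrite /cintegral2/=; congr (_ +i* _).
  apply: (@Rintegral_exchange _ _ _ _ R mu2 mu2
    (fun z => complex.Re (H z)) a b) => // x y.
  by rewrite (le_trans (normr_Re_le _)).
apply: (@Rintegral_exchange _ _ _ _ R mu2 mu2
  (fun z => complex.Im (H z)) a b) => // x y.
by rewrite (le_trans (normr_Im_le _)).
Qed.

Lemma measurable_parametric_cintegral2 d (T : measurableType d)
    (H : T * (R * R) -> R[i]) : cmeasurable H ->
  cmeasurable (fun t => cintegral2 (fun y => H (t, y))).
Proof.
move=> [H1 H2]; split.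
  exact: (@measurable_parametric_Rintegral _ _ _ _ R mu2 (fun z => complex.Re (H z))).
exact: (@measurable_parametric_Rintegral _ _ _ _ R mu2 (fun z => complex.Im (H z))).
Qed.

Lemma cabs_cintegral2_le F : cintegrable F ->
  cabs (cintegral2 F) <= 2 * \int[mu2]_x cabs (F x).
Proof.
move=> iF; have mF := cintegrable_measurable iF.
have ic : mu2.-integrable setT (EFin \o (fun x => cabs (F x))) by exact/cintegrableP.
have [i1 i2] := iF.
rewrite (le_trans (cabs_le _))// mulr_natl mulr2n lerD//.
  apply: (le_trans (le_normr_Rintegral _ i1)) => //.
  apply: le_Rintegral => //; first exact: (integrable_norm i1).
  by move=> x _; exact: normr_Re_le.
apply: (le_trans (le_normr_Rintegral _ i2)) => //.
apply: le_Rintegral => //; first exact: (integrable_norm i2).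
by move=> x _; exact: normr_Im_le.
Qed.

End complex_integrals.

(** * The Fourier integral is bounded on L^2 *)

Section complex_Bessel.
Context (R : realType).
Local Notation mu2 := (@lebesgue2 R).

Lemma integrable_trig_phase p q (s : R) (g : R * R -> R) y :
  mu2.-integrable setT (EFin \o g) ->
  mu2.-integrable setT (EFin \o (fun x => trig_phase p q s (y, x) * g x)).
Proof.
move=> ig; have /integrableP[/measurable_EFinP mg _] := ig.
apply: (@le_integrable _ _ _ mu2 _ measurableT _ (EFin \o g)) => //.
- apply/measurable_EFinP; apply: measurable_funM => //.
  exact: (measurableT_comp (measurable_trig_phase p q s)).
- by move=> x _; rewrite lee_fin normrM ler_piMl// trig_phase_le1.
Qed.

(** Changing the sign of the frequency multiplies the phase by a sign. *)
Lemma trig_transformN p q (s : R) (g : R * R -> R) y :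
  mu2.-integrable setT (EFin \o g) ->
  trig_transform p q (- s) g y ^+ 2 = trig_transform p q s g y ^+ 2.
Proof.
move=> ig.
have trigN r (u : R) : trig r (- u) = (-1) ^+ r * trig r u.
  by case: r; rewrite /trig ?sinN ?cosN ?expr1 ?expr0 ?mulN1r ?mul1r.
have -> : trig_transform p q (- s) g y =
    ((-1) ^+ p * (-1) ^+ q) * trig_transform p q s g y.
  rewrite /trig_transform -RintegralZl//; last exact: integrable_trig_phase.
  by apply: eq_Rintegral => x _; rewrite /trig_phase/= !mulNr !trigN; ring.
by rewrite exprMn -signr_addb sqrr_sign mul1r.
Qed.

Lemma trig_transform_L2_neq0 p q (s : R) (g : R * R -> R) : s != 0 ->
  mu2.-integrable setT (EFin \o g) ->
  (\int[mu2]_y (trig_transform p q s g y ^+ 2)%:E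
    <= ((80 / s) ^+ 2)%:E * \int[mu2]_x (g x ^+ 2)%:E)%E.
Proof.
move=> s0 ig; have [|s_lt0|s_eq0] := ltrgtP 0 s.
- by move=> s_gt0; exact: trig_transform_L2.
- have -> : (80 / s) ^+ 2 = (80 / - s) ^+ 2 by rewrite invrN mulrN sqrrN.
  have sN : 0 < - s by rewrite oppr_gt0.
  have <- : (\int[mu2]_y (trig_transform p q (- s) g y ^+ 2)%:E =
             \int[mu2]_y (trig_transform p q s g y ^+ 2)%:E)%E.
    by apply: eq_integral => y _; rewrite trig_transformN.
  exact: trig_transform_L2.
- by rewrite -s_eq0 eqxx in s0.
Qed.

Lemma Rintegral_sum4 (f1 f2 f3 f4 : R * R -> R) :
  mu2.-integrable setT (EFin \o f1) -> mu2.-integrable setT (EFin \o f2) ->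
  mu2.-integrable setT (EFin \o f3) -> mu2.-integrable setT (EFin \o f4) ->
  \int[mu2]_x (f1 x + f2 x + f3 x + f4 x) =
  \int[mu2]_x f1 x + \int[mu2]_x f2 x + \int[mu2]_x f3 x + \int[mu2]_x f4 x.
Proof.
move=> i1 i2 i3 i4.
have i12 := integrable_add i1 i2; have i123 := integrable_add i12 i3.
by rewrite RintegralD// RintegralD// RintegralD.
Qed.

Lemma sqr_sum4_le (a b c d : R) :
  (a + b + c + d) ^+ 2 <= 4 * (a ^+ 2 + b ^+ 2 + c ^+ 2 + d ^+ 2).
Proof.
have E : 4 * (a ^+ 2 + b ^+ 2 + c ^+ 2 + d ^+ 2) - (a + b + c + d) ^+ 2 =
    (a - b) ^+ 2 + (a - c) ^+ 2 + (a - d) ^+ 2 +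
    (b - c) ^+ 2 + (b - d) ^+ 2 + (c - d) ^+ 2 by ring.
by rewrite -subr_ge0 E; repeat apply: addr_ge0; exact: sqr_ge0.
Qed.

Lemma sume4 (F : bool * bool -> \bar R) p1 p2 p3 p4 :
  (\sum_(pq <- [:: p1; p2; p3; p4]) F pq = F p1 + (F p2 + (F p3 + F p4)))%E.
Proof. by rewrite !big_cons big_nil adde0. Qed.

(** Plancherel's inequality with a non-optimal constant.  The frequency [s] is kept so that
    dilations act on the constant only.  Each component of the integral is a
    sum of four real transforms, which costs a factor 4 in the square, and four
    such terms are added: (320 / s) ^ 2 is 16 * (80 / s) ^ 2. *)
Lemma cintegral2_phase_L2 (s : R) (G : R * R -> R[i]) : s != 0 ->
  cintegrable G ->
  (\int[mu2]_y (cabs (cintegral2 (fun x => G x * expi (s * dot2 y x))) ^+ 2)%:E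
    <= ((320 / s) ^+ 2)%:E * \int[mu2]_x (cabs (G x) ^+ 2)%:E)%E.
Proof.
move=> s0 iG; have [i1 i2] := iG.
have [m1 m2] := cintegrable_measurable iG.
pose g1 x := complex.Re (G x); pose g2 x := complex.Im (G x).
pose T p q g y := trig_transform p q s g y.
have dotE (x y : R * R) : s * dot2 y x = s * (y.1 * x.1) + s * (y.2 * x.2).
  by rewrite /dot2 mulrDr.
have iT p q y : mu2.-integrable setT (EFin \o (fun x => trig_phase p q s (y, x) * g1 x)).
  exact: integrable_trig_phase.
have iT' p q y : mu2.-integrable setT (EFin \o (fun x => trig_phase p q s (y, x) * g2 x)).
  exact: integrable_trig_phase.
have iN f : mu2.-integrable setT (EFin \o f) -> mu2.-integrable setT (EFin \o (fun x => -1 * f x)).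
  exact: integrable_scale.
have intN f : mu2.-integrable setT (EFin \o f) -> \int[mu2]_x (-1 * f x) = - \int[mu2]_x f x.
  by move=> fi; rewrite RintegralZl// mulN1r.
have ReE y : complex.Re (cintegral2 (fun x => G x * expi (s * dot2 y x))) =
    T false false g1 y + (- T true true g1 y) + (- T true false g2 y) + (- T false true g2 y).
  rewrite /T /trig_transform -!intN// -Rintegral_sum4//; try exact: iN.
  apply: eq_Rintegral => x _.
  by rewrite Re_mulc/= dotE cosD sinD /trig_phase /trig /g1 /g2/=; ring.
have ImE y : complex.Im (cintegral2 (fun x => G x * expi (s * dot2 y x))) =
    T true false g1 y + T false true g1 y + T false false g2 y + (- T true true g2 y).
  rewrite /T /trig_transform -!intN// -Rintegral_sum4//; try exact: iN.
  apply: eq_Rintegral => x _.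
  by rewrite Im_mulc/= dotE cosD sinD /trig_phase /trig /g1 /g2/=; ring.
pose A (pq : bool * bool) y : \bar R :=
  (4 * (T pq.1 pq.2 g1 y ^+ 2 + T pq.1 pq.2 g2 y ^+ 2))%:E.
(* The pairs (p, q) that occur in the addition formulas below; each of the two
   components of the integral is a signed sum of four transforms. *)
pose ps := [:: (false, false); (true, true); (true, false); (false, true)].
have mT p q g : measurable_fun setT g -> measurable_fun setT (fun y => T p q g y ^+ 2).
  by move=> mg; apply: measurable_funX; exact: measurable_trig_transform.
have mA pq : measurable_fun setT (A pq).
  apply/measurable_EFinP; apply: measurable_funM => //.
  by apply: measurable_funD; exact: mT.
have A0 pq y : (0 <= A pq y)%E by rewrite lee_fin mulr_ge0// addr_ge0// sqr_ge0.
have mG : cmeasurable (fun y => cintegral2 (fun x => G x * expi (s * dot2 y x))).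
  apply: (@measurable_parametric_cintegral2 _ _ _
    (fun z => G z.2 * expi (s * dot2 z.1 z.2))).
  apply: cmeasurableM.
    by apply: cmeasurable_comp (cintegrable_measurable iG).
  apply: cmeasurable_expi; apply: measurable_funM => //.
  by apply: measurable_funD; apply: measurable_funM; do 2 apply: measurableT_comp => //.
apply: (@le_trans _ _ (\int[mu2]_y (\sum_(pq <- ps) A pq y))%E).
  apply: ge0_le_integral => //.
  - by move=> y _; rewrite lee_fin sqr_ge0.
  - by apply/measurable_EFinP; apply: measurable_funX; exact: measurable_cabs.
  - exact: emeasurable_sum.
  move=> y _; rewrite cabs_sqr ReE ImE sume4 /A/= -!EFinD lee_fin.
  rewrite (le_trans (lerD (sqr_sum4_le _ _ _ _) (sqr_sum4_le _ _ _ _)))//.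
  rewrite !sqrrN; lra.
rewrite ge0_integral_sum//.
have g12 : (\int[mu2]_x (cabs (G x) ^+ 2)%:E =
    \int[mu2]_x (g1 x ^+ 2)%:E + \int[mu2]_x (g2 x ^+ 2)%:E)%E.
  rewrite -ge0_integralD//.
  - by apply: eq_integral => x _; rewrite cabs_sqr EFinD.
  - by move=> x _; rewrite lee_fin sqr_ge0.
  - by apply/measurable_EFinP; exact: measurable_funX.
  - by move=> x _; rewrite lee_fin sqr_ge0.
  - by apply/measurable_EFinP; exact: measurable_funX.
set I := (\int[mu2]_x (cabs (G x) ^+ 2)%:E)%E.
have I0 : (0 <= I)%E by apply: integral_ge0 => x _; rewrite lee_fin sqr_ge0.
have Ale pq : (\int[mu2]_y A pq y <= ((160 / s) ^+ 2)%:E * I)%E.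
  have mT1 : measurable_fun setT (fun y => (T pq.1 pq.2 g1 y ^+ 2)%:E).
    by apply/measurable_EFinP; exact: mT.
  have mT2 : measurable_fun setT (fun y => (T pq.1 pq.2 g2 y ^+ 2)%:E).
    by apply/measurable_EFinP; exact: mT.
  have T0 g y : (0 <= (T pq.1 pq.2 g y ^+ 2)%:E)%E by rewrite lee_fin sqr_ge0.
  have -> : (\int[mu2]_y A pq y = 4%:E * (\int[mu2]_y (T pq.1 pq.2 g1 y ^+ 2)%:E +
      \int[mu2]_y (T pq.1 pq.2 g2 y ^+ 2)%:E))%E.
    rewrite -ge0_integralD// -ge0_integralZl//.
    - exact: emeasurable_funD.
    - by move=> y _; exact: adde_ge0.
  rewrite (_ : (160 / s) ^+ 2 = 4 * ((80 / s) ^+ 2)); last by field.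
  rewrite EFinM -muleA lee_wpmul2l// /I g12 ge0_muleDr.
  - by rewrite leeD// trig_transform_L2_neq0.
  - by apply: integral_ge0 => x _; rewrite lee_fin sqr_ge0.
  - by apply: integral_ge0 => x _; rewrite lee_fin sqr_ge0.
rewrite [leLHS](sume4 (fun pq => \int[mu2]_y A pq y)%E).
rewrite (_ : (320 / s) ^+ 2 = (160 / s) ^+ 2 + ((160 / s) ^+ 2 +
  ((160 / s) ^+ 2 + (160 / s) ^+ 2))); last by field.
have K0 : (0 <= ((160 / s) ^+ 2)%:E)%E by rewrite lee_fin sqr_ge0.
by rewrite !EFinD !ge0_muleDl ?adde_ge0// !leeD// Ale.
Qed.

End complex_Bessel.

(** * Dilations *)

Section scaling.
Context (R : realType).
Local Notation leb := (@lebesgue_measure R).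
Local Notation mu2 := (@lebesgue2 R).

(** Both sides are measures in [A] that agree on half-open intervals. *)
Lemma lebesgue_measure_scale (t : R) (t0 : 0 < t) (A : set R) : measurable A ->
  leb A = (t%:E * leb (( *%R t) @^-1` A))%E.
Proof.
move=> mA.
have mt : measurable_fun setT ( *%R t : measurableTypeR R -> measurableTypeR R).
  exact: measurable_funM.
pose push : {measure set (measurableTypeR R) -> \bar R} := 
  [the measure _ _ of pushforward leb ( *%R t : measurableTypeR R -> measurableTypeR R)].
have tn : 0 <= t by exact: ltW.
pose m : {measure set (measurableTypeR R) -> \bar R} := mscale (NngNum tn) (push mt).
apply: (@lebesgue_measure_unique R m) => // _ [[a b]] _ <-.
rewrite /m/= /mscale/= /pushforward.
have -> : ( *%R t) @^-1` `]a, b]%classic = `]a / t, b / t]%classic.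
  apply/seteqP; split=> x /=; rewrite !in_itv/= ltr_pdivrMr// ler_pdivlMr// mulrC//.
rewrite !lebesgue_measure_itv/= !lte_fin ltr_pM2r ?invr_gt0//.
case: ifPn => _; last by rewrite mule0.
by rewrite -!EFinB -EFinM -mulrBl mulrCA divff ?mulr1 ?lt0r_neq0.
Qed.

Lemma ge0_integral_scale (t : R) (f : R -> \bar R) : 0 < t ->
  measurable_fun setT f -> (forall x, 0 <= f x)%E ->
  (\int[leb]_x f x = t%:E * \int[leb]_x f (t * x)%R)%E.
Proof.
move=> t0 mf f0.
have mt : measurable_fun setT ( *%R t : measurableTypeR R -> measurableTypeR R).
  exact: measurable_funM.
pose push : {measure set (measurableTypeR R) -> \bar R} :=
  [the measure _ _ of pushforward leb ( *%R t : measurableTypeR R -> measurableTypeR R)].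
have tn : 0 <= t by exact: ltW.
transitivity (\int[mscale (NngNum tn) (push mt)]_x f x)%E.
  by apply: eq_measure_integral => A mA _; exact: lebesgue_measure_scale.
rewrite ge0_integral_mscale//; congr (_ * _)%E.
rewrite /push/= (@ge0_integral_pushforward _ _ _ _ _ _ mt)//.
Qed.

Lemma ge0_integral_scale2 (t : R) (f : R * R -> \bar R) : 0 < t ->
  measurable_fun setT f -> (forall x, 0 <= f x)%E ->
  (\int[mu2]_x f x = (t ^+ 2)%:E * \int[mu2]_x f (t * x.1, t * x.2)%R)%E.
Proof.
move=> t0 mf f0.
have mft : measurable_fun setT (fun x : R * R => f (t * x.1, t * x.2)%R).
  by apply: measurableT_comp => //; apply: measurable_fun_pair;
    apply: measurable_funM => //.
rewrite !ge0_integral_lebesgue2//=.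
have mI : measurable_fun setT (fun x => \int[leb]_y f (x, y))%E.
  exact: (@measurable_fun_fubini_tonelli_F _ _ _ _ R leb f mf f0).
rewrite (ge0_integral_scale t0 mI); last by move=> x; exact: integral_ge0.
rewrite expr2 EFinM -muleA; congr (_ * _)%E.
have mI' := @measurable_fun_fubini_tonelli_F _ _ _ _ R leb _ mft (fun x => f0 _).
rewrite -ge0_integralZl//; last 2 first.
- by move=> x _; exact: integral_ge0.
- by rewrite lee_fin ltW.
apply: eq_integral => x _; rewrite (ge0_integral_scale t0)//.
exact: measurableT_comp.
Qed.

End scaling.

(** * Convolution with a dilated kernel as a Fourier multiplier *)

Definition fourier (R : realType) (f : R * R -> R[i]) (eta : R * R) : R[i] :=
  cintegral2 (fun y => f y * expi (- (2 * pi) * dot2 eta y)).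

Section convolution.
Context (R : realType).
Local Notation mu2 := (@lebesgue2 R).

Lemma measurable_dot2 d (T : measurableType d) (u v : T -> R * R) :
  measurable_fun setT u -> measurable_fun setT v ->
  measurable_fun setT (fun x => dot2 (u x) (v x)).
Proof.
by move=> mu mv; apply: measurable_funD; apply: measurable_funM;
  exact: measurableT_comp.
Qed.

Lemma cmeasurable_inverse_fourier (F : R * R -> R[i]) : cmeasurable F ->
  cmeasurable (inverse_fourier F).
Proof.
move=> mF; apply: (@measurable_parametric_cintegral2 _ _ _
  (fun z => F z.2 * expi (2 * pi * dot2 z.1 z.2))).
apply: cmeasurableM; first exact: cmeasurable_comp mF.
by apply: cmeasurable_expi; apply: measurable_funM => //; exact: measurable_dot2.
Qed.

Lemma cmeasurable_fourier (F : R * R -> R[i]) : cmeasurable F ->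
  cmeasurable (fourier F).
Proof.
move=> mF; apply: (@measurable_parametric_cintegral2 _ _ _
  (fun z => F z.2 * expi (- (2 * pi) * dot2 z.1 z.2))).
apply: cmeasurableM; first exact: cmeasurable_comp mF.
by apply: cmeasurable_expi; apply: measurable_funM => //; exact: measurable_dot2.
Qed.

(** Fubini's theorem: the factor exp(2 pi i x.xi/t) does not depend on the
    variable of [f], whose integral then reconstitutes the Fourier transform
    at [xi / t]. *)
Lemma convolution_dilation_fourier (Psi f : R * R -> R[i]) (t : R) (x : R * R) :
  0 < t -> cintegrable Psi -> cintegrable f ->
  convolution (dilation (inverse_fourier Psi) t) f x =
  cintegral2 (fun xi => ((t ^- 2)%:C * Psi xi * fourier f (t^-1 * xi.1, t^-1 * xi.2))
    * expi (2 * pi / t * dot2 x xi)).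
Proof.
move=> t0 iP iF.
have mP := cintegrable_measurable iP; have mF := cintegrable_measurable iF.
have tC : t^-1 * t = 1 by rewrite mulVf// lt0r_neq0.
pose H (z : (R * R) * (R * R)) : R[i] := ((t ^- 2)%:C * f z.1) *
  (Psi z.2 * expi (2 * pi * dot2 (t^-1 * (x - z.1).1, t^-1 * (x - z.1).2) z.2)).
have mdot : measurable_fun setT (fun z : (R * R) * (R * R) =>
    2 * pi * dot2 (t^-1 * (x - z.1).1, t^-1 * (x - z.1).2) z.2).
  apply: measurable_funM => //; apply: measurable_dot2 => //.
  by apply: measurable_fun_pair; apply: measurable_funM => //;
    apply: measurable_funB => //; do 2 apply: measurableT_comp => //.
have mH : cmeasurable H.
  apply: cmeasurableM.
    apply: cmeasurableM; first exact: cmeasurable_cst.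
    exact: cmeasurable_comp mF.
  apply: cmeasurableM; first exact: cmeasurable_comp mP.
  exact: cmeasurable_expi.
transitivity (cintegral2 (fun y => cintegral2 (fun xi => H (y, xi)))).
  rewrite /convolution /dilation /inverse_fourier; congr cintegral2.
  apply/funext => y; rewrite mulrAC -cintegral2Zl//.
  apply: cintegrable_phase => //.
  by apply: measurable_funM => //; exact: measurable_dot2.
rewrite (@cintegral2_exchange _ H (fun y => t ^- 2 * cabs (f y)) (fun xi => cabs (Psi xi)))//.
- congr cintegral2; apply/funext => xi.
  rewrite mulrAC -cintegral2Zl; last first.
    by apply: cintegrable_phase => //; apply: measurable_funM => //; exact: measurable_dot2.
  congr cintegral2; apply/funext => y; rewrite /H/=.
  rewrite (_ : 2 * pi * dot2 _ _ =
    2 * pi / t * dot2 x xi + - (2 * pi) * dot2 (t^-1 * xi.1, t^-1 * xi.2) y).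
    by rewrite expiD; ring.
  by rewrite /dot2/=; ring.
- by apply: integrable_scale; exact/cintegrableP.
- exact/cintegrableP.
- move=> y xi; rewrite /H/= !cabsM cabs_expi mulr1 cabs_real ger0_norm//.
  by rewrite invr_ge0 sqr_ge0.
Qed.

Lemma cabs_fourier_le (f : R * R -> R[i]) eta : cintegrable f ->
  cabs (fourier f eta) <= 2 * \int[mu2]_x cabs (f x).
Proof.
move=> iF; rewrite (le_trans (cabs_cintegral2_le _))//.
  apply: cintegrable_phase => //.
  by apply: measurable_funM => //; exact: measurable_dot2.
rewrite ler_pM2l// le_eqVlt; apply/orP; left; apply/eqP.
by apply: eq_Rintegral => x _; rewrite cabsM cabs_expi mulr1.
Qed.

(** The square of [t ^ -2] and the constant [s ^ -2], [s = 2 pi / t], of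
    Plancherel's inequality leave [t ^ -2], which the substitution
    [xi = t eta] absorbs. *)
Lemma convolution_dilation_L2 (Psi f : R * R -> R[i]) (t : R) :
  0 < t -> cintegrable Psi -> cintegrable f ->
  (\int[mu2]_x (cabs (convolution (dilation (inverse_fourier Psi) t) f x) ^+ 2)%:E
   <= ((160 / pi) ^+ 2)%:E * \int[mu2]_eta
     ((cabs (Psi (t * eta.1, t * eta.2)%R) * cabs (fourier f eta)) ^+ 2)%:E)%E.
Proof.
move=> t0 iP iF.
have mP := cintegrable_measurable iP; have mF := cintegrable_measurable iF.
have p0 : 0 < pi :> R by exact: pi_gt0.
pose G xi := (t ^- 2)%:C * Psi xi * fourier f (t^-1 * xi.1, t^-1 * xi.2).
have mscale : measurable_fun setT (fun xi : R * R => (t^-1 * xi.1, t^-1 * xi.2)).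
  by apply: measurable_fun_pair; apply: measurable_funM => //.
have mG : cmeasurable G.
  apply: cmeasurableM.
    by apply: cmeasurableM => //; exact: cmeasurable_cst.
  exact: (cmeasurable_comp mscale (cmeasurable_fourier mF)).
have tn2 : 0 <= t ^- 2 by rewrite invr_ge0 sqr_ge0.
have iG : cintegrable G.
  apply: (cintegrable_dominated mG (a := fun xi =>
    (t ^- 2 * (2 * \int[mu2]_x cabs (f x))) * cabs (Psi xi))).
    by apply: integrable_scale; exact/cintegrableP.
  move=> xi; rewrite /G !cabsM cabs_real ger0_norm// mulrAC.
  by rewrite ler_wpM2r ?cabs_ge0// ler_wpM2l// cabs_fourier_le.
under eq_integral do rewrite convolution_dilation_fourier//.
have s0 : 2 * pi / t != 0 by rewrite mulf_neq0 ?invr_eq0// ?mulf_neq0// lt0r_neq0.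
apply: (le_trans (cintegral2_phase_L2 s0 iG)).
have mG2 : measurable_fun setT (fun x => (cabs (G x) ^+ 2)%:E).
  by apply/measurable_EFinP; apply: measurable_funX; exact: measurable_cabs.
rewrite (ge0_integral_scale2 t0 mG2); last by move=> x; rewrite lee_fin sqr_ge0.
rewrite muleA -EFinM -ge0_integralZl//; first last.
- by rewrite lee_fin; apply: mulr_ge0; exact: sqr_ge0.
- by move=> x _; rewrite lee_fin sqr_ge0.
- by apply: (measurableT_comp mG2); apply: measurable_fun_pair; apply: measurable_funM => //.
rewrite -ge0_integralZl//; first last.
- by rewrite lee_fin sqr_ge0.
- by move=> x _; rewrite lee_fin sqr_ge0.
- apply/measurable_EFinP; apply: measurable_funX; apply: measurable_funM.
    apply: measurable_cabs; apply: cmeasurable_comp mP.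
    by apply: measurable_fun_pair; apply: measurable_funM => //.
  by apply: measurable_cabs; exact: cmeasurable_fourier.
rewrite le_eqVlt; apply/orP; left; apply/eqP; apply: eq_integral => -[x y] _.
rewrite -!EFinM; congr (_%:E); rewrite /G; cbn [fst snd]; rewrite !cabsM cabs_real ger0_norm//.
have tK r : t^-1 * (t * r) = r by rewrite mulrA mulVf ?mul1r// lt0r_neq0.
rewrite !tK.
have cE (p : R) : p != 0 -> 320 / (2 * p / t) = 160 / p * t.
  by move=> pn0; field; rewrite pn0 lt0r_neq0.
rewrite cE ?lt0r_neq0//; move: (160 / pi) (cabs _) (cabs _) => u v w.
by field; rewrite lt0r_neq0.
Qed.

End convolution.

(** * From ray integrals to the square function *)

Section multiplier.
Context (R : realType).
Local Notation leb := (@lebesgue_measure R).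
Local Notation mu2 := (@lebesgue2 R).

Lemma mem_pos (t : R) : (t \in `]0%R, +oo[%classic) = (0 < t).
Proof. by rewrite mem_setE in_itv/= andbT. Qed.

Lemma integral_pos_indicator (u : R -> R) :
  (\int[leb]_(t in `]0%R, +oo[) (u t)%:E =
   \int[leb]_t (\1_(`]0%R, +oo[%classic) t * u t)%:E)%E.
Proof.
rewrite integral_mkcond; apply: eq_integral => t _.
by rewrite patchE indicE; case: ifPn => _; rewrite ?mul1r ?mul0r.
Qed.

(** Tonelli's theorem is used twice: to bring the integral in [t] outside so
    that Plancherel's inequality applies for each [t], and then to bring it
    inside against the hypothesis on rays. *)
Lemma littlewood_paley_multiplier (Psi f : R * R -> R[i]) (A : R) :
  cintegrable Psi -> cintegrable f ->
  (forall xi, \int[leb]_(t in `]0%R, +oo[)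
    (cabs (Psi (t * xi.1, t * xi.2)) ^+ 2 / t)%:E <= A%:E)%E ->
  (\int[mu2]_x \int[leb]_(t in `]0%R, +oo[)
    (cabs (convolution (dilation (inverse_fourier Psi) t) f x) ^+ 2 / t)%:E
  <= ((160 / pi) ^+ 2 * A * (320 / - (2 * pi)) ^+ 2)%:E *
     \int[mu2]_x (cabs (f x) ^+ 2)%:E)%E.
Proof.
move=> iP iF PA.
have mP := cintegrable_measurable iP; have mF := cintegrable_measurable iF.
have p0 : 0 < pi :> R by exact: pi_gt0.
(* t^-1 written as a power, which is measurable on the whole line. *)
pose tau (t : R) := t `^ (-1).
pose one (t : R) : R := \1_(`]0%R, +oo[%classic) t.
have one0 t : 0 <= one t by [].
have tau0 t : 0 <= tau t by exact: powR_ge0.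
have mtau : measurable_fun setT tau by exact: measurable_powR.
have mone : measurable_fun setT one by exact: measurable_indic.
pose h := inverse_fourier Psi.
have mh : cmeasurable h by exact: cmeasurable_inverse_fourier.
pose C (z : (R * R) * R) := cintegral2 (fun y => ((tau z.2) ^+ 2)%:C *
  h (tau z.2 * (z.1 - y).1, tau z.2 * (z.1 - y).2) * f y).
have mC : cmeasurable C.
  apply: (@measurable_parametric_cintegral2 R _ _ (fun w : ((R * R) * R) * (R * R) => ((tau w.1.2) ^+ 2)%:C *
    h (tau w.1.2 * (w.1.1 - w.2).1, tau w.1.2 * (w.1.1 - w.2).2) * f w.2)).
  have mt : measurable_fun setT (fun w : ((R * R) * R) * (R * R) => tau w.1.2).
    by apply: (measurableT_comp mtau); exact: measurableT_comp.
  apply: cmeasurableM; last exact: cmeasurable_comp mF.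
  apply: cmeasurableM.
    by apply: cmeasurable_real; exact: measurable_funX.
  apply: cmeasurable_comp mh; apply: measurable_fun_pair; apply: measurable_funM => //;
    apply: measurable_funB; do ?[exact: measurableT_comp];
    by do 2 apply: measurableT_comp => //.
have CE x t : 0 < t -> convolution (dilation h t) f x = C (x, t).
  by move=> t0; rewrite /C/= /tau powR_inv1 ?(ltW t0)// exprVn.
pose W (z : (R * R) * R) : \bar R := (one z.2 * (cabs (C z) ^+ 2 * tau z.2))%:E.
have mW : measurable_fun setT W.
  apply/measurable_EFinP; apply: measurable_funM; first exact: measurableT_comp.
  apply: measurable_funM; last exact: measurableT_comp.
  by apply: measurable_funX; exact: measurable_cabs.
have W0 z : (0 <= W z)%E by rewrite lee_fin mulr_ge0// mulr_ge0// sqr_ge0.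
pose V (z : R * (R * R)) : \bar R := (one z.1 * (tau z.1 *
  (cabs (Psi (z.1 * z.2.1, z.1 * z.2.2)) * cabs (fourier f z.2)) ^+ 2))%:E.
have mPt : measurable_fun setT (fun z : R * (R * R) => cabs (Psi (z.1 * z.2.1, z.1 * z.2.2))).
  apply: measurable_cabs; apply: cmeasurable_comp mP.
  by apply: measurable_fun_pair; apply: measurable_funM => //; apply: measurableT_comp.
have mFf : measurable_fun setT (fun eta => cabs (fourier f eta)).
  by apply: measurable_cabs; exact: cmeasurable_fourier.
have mV : measurable_fun setT V.
  apply/measurable_EFinP; apply: measurable_funM; first exact: measurableT_comp.
  apply: measurable_funM; first exact: measurableT_comp.
  apply: measurable_funX; apply: measurable_funM => //.
  exact: (measurableT_comp mFf).
have V0 z : (0 <= V z)%E by rewrite lee_fin mulr_ge0// mulr_ge0// sqr_ge0.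
have -> : (\int[mu2]_x \int[leb]_(t in `]0%R, +oo[)
    (cabs (convolution (dilation h t) f x) ^+ 2 / t)%:E =
    \int[mu2]_x \int[leb]_t W (x, t))%E.
  apply: eq_integral => x _; rewrite -integral_pos_indicator.
  apply: eq_integral => t; rewrite mem_pos => t0.
  by rewrite CE// /tau powR_inv1 ?ltW//.
(* Plancherel's inequality for each t. *)
rewrite (@fubini_tonelli _ _ _ _ R mu2 leb W)//.
apply: (@le_trans _ _ (((160 / pi) ^+ 2)%:E * \int[leb]_t \int[mu2]_eta V (t, eta))%E).
  rewrite -ge0_integralZl//; first last.
  - by rewrite lee_fin sqr_ge0.
  - by move=> t _; exact: integral_ge0.
  - exact: (@measurable_fun_fubini_tonelli_F _ _ _ _ R mu2 V).
  apply: ge0_le_integral => //.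
  - by move=> t _; exact: integral_ge0.
  - exact: (@measurable_fun_fubini_tonelli_G _ _ _ _ R mu2 W).
  - apply: emeasurable_funM => //.
    exact: (@measurable_fun_fubini_tonelli_F _ _ _ _ R mu2 V).
  move=> t _; rewrite /W /V; cbn [fst snd].
  have [t0|t0] := ltP 0 t; last first.
    rewrite integral0_eq; last first.
      move=> x _; rewrite /one indicE memNset ?mul0r//=.
      by rewrite in_itv/= andbT; apply/negP; rewrite -leNgt.
    by rewrite mule_ge0// ?lee_fin ?sqr_ge0// integral_ge0// => z _; exact: V0 (t, z).
  have one1 : one t = 1 by rewrite /one indicE mem_set//= in_itv/= andbT.
  rewrite one1.
  have mCt : measurable_fun setT (fun x => (cabs (C (x, t)) ^+ 2)%:E).
    apply/measurable_EFinP; apply: measurable_funX.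
    by apply: (measurableT_comp (measurable_cabs mC)); exact: measurable_fun_pair.
  have mPF : measurable_fun setT (fun x => ((cabs (Psi (t * x.1, t * x.2)) * cabs (fourier f x)) ^+ 2)%:E).
    apply/measurable_EFinP; apply: measurable_funX; apply: measurable_funM => //.
    apply: (@measurableT_comp _ _ _ _ _ _ _ _ (fun x => (t, x)) mPt).
    exact: measurable_fun_pair.
  under eq_integral do rewrite mul1r EFinM.
  rewrite ge0_integralZr//; last 2 first.
  - by move=> x _; rewrite lee_fin sqr_ge0.
  - by rewrite lee_fin.
  under [in leRHS]eq_integral do rewrite mul1r EFinM.
  rewrite ge0_integralZl//; last 2 first.
  - by move=> x _; rewrite lee_fin sqr_ge0.
  - by rewrite lee_fin.
  rewrite muleC muleCA lee_wpmul2l ?lee_fin//.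
  under eq_integral do rewrite -CE//.
  exact: convolution_dilation_L2.
rewrite (@fubini_tonelli _ _ _ _ R leb mu2 V)//.
have A0 : (0 <= A%:E)%E.
  by rewrite (le_trans _ (PA (0, 0)))// integral_ge0// => t/=; rewrite in_itv/= andbT => t0;
    rewrite lee_fin mulr_ge0 ?sqr_ge0// invr_ge0 ltW.
have mF2 : measurable_fun setT (fun x => (cabs (fourier f x) ^+ 2)%:E).
  by apply/measurable_EFinP; exact: measurable_funX.
have F0 x : (0 <= (cabs (fourier f x) ^+ 2)%:E)%E by rewrite lee_fin sqr_ge0.
apply: (@le_trans _ _ (((160 / pi) ^+ 2)%:E * (A%:E * \int[mu2]_x (cabs (fourier f x) ^+ 2)%:E))%E).
  rewrite lee_wpmul2l ?lee_fin ?sqr_ge0// -ge0_integralZl//.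
  apply: ge0_le_integral => //.
  - by move=> x _; exact: integral_ge0.
  - exact: (@measurable_fun_fubini_tonelli_G _ _ _ _ R leb V).
  - exact: emeasurable_funM.
  move=> x _.
  apply: le_trans (lee_wpmul2r (F0 x) (PA x)).
  have mPx : measurable_fun setT (fun t : R => one t * (cabs (Psi (t * x.1, t * x.2)) ^+ 2 * tau t)).
    apply: measurable_funM => //; apply: measurable_funM => //; apply: measurable_funX.
    apply: (@measurableT_comp _ _ _ _ _ _ _ _ (fun t => (t, x)) mPt).
    exact: measurable_fun_pair.
  have -> : (\int[leb]_(t in `]0%R, +oo[) (cabs (Psi (t * x.1, t * x.2)) ^+ 2 / t)%:E =
      \int[leb]_t (one t * (cabs (Psi (t * x.1, t * x.2)) ^+ 2 * tau t))%:E)%E.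
    rewrite -integral_pos_indicator; apply: eq_integral => t.
    by rewrite mem_pos => t0; rewrite /tau powR_inv1 ?ltW//.
  rewrite -ge0_integralZr//; last 2 first.
  - exact/measurable_EFinP.
  - by move=> t _; rewrite lee_fin mulr_ge0// mulr_ge0// sqr_ge0.
  rewrite le_eqVlt; apply/orP; left; apply/eqP; apply: eq_integral => t _.
  by rewrite /V -EFinM; cbn [fst snd]; congr (_%:E); ring.
rewrite (EFinM (_ * A)) (EFinM _ A) -!muleA lee_wpmul2l ?lee_fin ?sqr_ge0// lee_wpmul2l//.
have s0 : - (2 * pi) != 0 :> R by rewrite oppr_eq0 mulf_neq0// lt0r_neq0.
exact: cintegral2_phase_L2.
Qed.

End multiplier.

(** * The primitive 1 / ln (2 + 1/r) *)

Definition loginv (R : realType) (r : R) : R := ln (2 + r^-1).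

Definition log_primitive (R : realType) (r : R) : R := (loginv r)^-1.

(** The derivative of [log_primitive], namely 1 / (r (1 + 2 r) ln^2 (2 +
    1/r)). *)
Definition log_density (R : realType) (r : R) : R :=
  (loginv r ^+ 2 * (2 * r ^+ 2 + r))^-1.

Section log_primitive.
Context (R : realType).
Implicit Types r M : R.

Lemma ln_two_gt0 : 0 < ln 2 :> R.
Proof. by rewrite ln_gt0// ltr1n. Qed.

Lemma loginv_ge r : 0 < r -> ln 2 <= loginv r.
Proof.
by move=> r0; rewrite ler_ln ?posrE// ?lerDl ?invr_ge0 ?(ltW r0)// addr_gt0// invr_gt0.
Qed.

Lemma loginv_gt0 r : 0 < r -> 0 < loginv r.
Proof. by move=> r0; rewrite (lt_le_trans ln_two_gt0)// loginv_ge. Qed.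

Lemma loginv_decreasing r s : 0 < r -> r <= s -> loginv s <= loginv r.
Proof.
move=> r0 rs; have s0 := lt_le_trans r0 rs.
rewrite ler_ln ?posrE ?addr_gt0 ?invr_gt0//.
by rewrite lerD2l lef_pV2.
Qed.

Lemma log_density_gt0 r : 0 < r -> 0 < log_density r.
Proof.
by move=> r0; rewrite invr_gt0 mulr_gt0// ?exprn_gt0 ?loginv_gt0// addr_gt0// mulr_gt0// exprn_gt0.
Qed.

Lemma log_primitive_le r : 0 < r -> `|log_primitive r| <= (ln 2)^-1.
Proof.
move=> r0; rewrite ger0_norm ?invr_ge0 ?(ltW (loginv_gt0 r0))//.
by rewrite lef_pV2 ?posrE ?loginv_gt0 ?ln_two_gt0// loginv_ge.
Qed.

Lemma is_derive_log_primitive r : 0 < r ->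
  is_derive r 1 (@log_primitive R) (log_density r).
Proof.
move=> r0.
have scaleE (a b : R) : a *: (b : R^o) = a * b by [].
have dV : is_derive r 1 (fun r => 2 + r^-1) (- r ^- 2).
  have h := is_deriveD (is_derive_cst (2 : R) r 1) (is_deriveV (lt0r_neq0 r0) (is_derive_id r 1)).
  by apply: (is_derive_eq h); rewrite add0r scaleE mulr1.
have x0 : 0 < 2 + r^-1 by rewrite addr_gt0// invr_gt0.
have dl : is_derive r 1 (@loginv R) ((2 + r^-1)^-1 * (- r ^- 2)).
  exact: (@is_derive1_comp R _ (fun r => 2 + r^-1) _ _ _ (is_derive1_ln x0) dV).
have h := is_deriveV (lt0r_neq0 (loginv_gt0 r0)) dl.
apply: (is_derive_eq h); rewrite scaleE /log_density.
have l0 := lt0r_neq0 (loginv_gt0 r0); have rn := lt0r_neq0 r0.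
have r21 : 1 + 2 * r != 0 by rewrite lt0r_neq0// addr_gt0// mulr_gt0.
have r22 : 2 * r ^+ 2 + r != 0 by rewrite lt0r_neq0// addr_gt0// mulr_gt0// exprn_gt0.
by field; rewrite r22 l0 rn addrC.
Qed.

(** With [e = 2 lambda + 1] and [p = 2 - 2 theta] this compares phi^2 with
    1 / (r ln^2 (2 + 1/r)).  If [e = 0] the negative power of the logarithm is
    bounded because ln (2 + 1/r) >= ln 2; if [e > 0] any power of the logarithm
    is absorbed by ln x <= x^d / d. *)
Lemma powR_bound M e p : 0 < M -> (e = 0 /\ p < 0) \/ 0 < e ->
  exists2 K, 0 <= K & forall r, 0 < r <= M -> r `^ e * loginv r `^ p <= K.
Proof.
have negN q r : 0 <= q -> 0 < r -> loginv r `^ (- q) <= ln 2 `^ (- q).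
  move=> q0 r0; rewrite !powRN lef_pV2 ?posrE ?powR_gt0 ?loginv_gt0 ?ln_two_gt0//.
  by rewrite ge0_ler_powR ?nnegrE ?loginv_ge// ltW// ?loginv_gt0// ln_two_gt0.
have neg q r : q <= 0 -> 0 < r -> loginv r `^ q <= ln 2 `^ q.
  by move=> q0 r0; rewrite -[q]opprK negN// oppr_ge0.
move=> M0 [[-> p0]|e0].
  exists (ln 2 `^ p); first exact: powR_ge0.
  by move=> r /andP[r0 _]; rewrite powRr0 mul1r neg// ltW.
(* q >= p, and d q = e: the power q of the logarithm costs (2 + 1/r)^e, which
   r^e compensates. *)
pose q := `|p| + 1; pose d := e / q.
have q0 : 0 < q by rewrite ltr_wpDl.
have d0 : 0 < d by rewrite divr_gt0.
exists ((d^-1 `^ q * (2 * M + 1) `^ e) * ln 2 `^ (p - q)).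
  by rewrite !mulr_ge0 ?powR_ge0.
move=> r /andP[r0 rM].
have x0 : 0 < 2 + r^-1 by rewrite addr_gt0// invr_gt0.
have -> : loginv r `^ p = loginv r `^ q * loginv r `^ (p - q).
  by rewrite -powRD ?(addrC q) ?subrK// (lt0r_neq0 (loginv_gt0 r0)) implybT.
rewrite mulrA; apply: ler_pM; rewrite ?mulr_ge0 ?powR_ge0//; last first.
  by rewrite neg// subr_le0 (le_trans (ler_norm _))// lerDl.
have Lx : loginv r <= d^-1 * (2 + r^-1) `^ d.
  rewrite ler_pdivlMl// -ln_powR ltW// ln_sublinear// powR_gt0//.
apply: (@le_trans _ _ (r `^ e * (d^-1 * (2 + r^-1) `^ d) `^ q)).
  rewrite ler_wpM2l ?powR_ge0// ge0_ler_powR// ?nnegrE ?(ltW q0)//.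
    by rewrite ltW// loginv_gt0.
  by rewrite mulr_ge0 ?powR_ge0// invr_ge0 ltW.
rewrite powRM ?powR_ge0 ?invr_ge0 ?(ltW d0)// -powRrM /d divfK ?lt0r_neq0//.
rewrite mulrCA ler_wpM2l ?powR_ge0// -powRM ?(ltW r0) ?(ltW x0)//.
rewrite ge0_ler_powR ?nnegrE ?(ltW e0)//.
- by rewrite mulr_ge0// ltW.
- by rewrite addr_ge0// mulr_ge0// ltW.
- by rewrite mulrDr divff ?lt0r_neq0// lerD2r mulrC ler_wpM2l.
Qed.

Lemma phi_sqrE (lambda theta : R) r : 0 < r ->
  phi lambda theta r ^+ 2 =
  r `^ (2 * lambda + 1) * loginv r `^ (2 - 2 * theta) / (r * loginv r ^+ 2).
Proof.
move=> r0; have L0 := loginv_gt0 r0.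
have sq (x y : R) : (x `^ y) ^+ 2 = x `^ (y * 2).
  by rewrite powRrM powR_mulrn// powR_ge0.
rewrite /phi r0 exprMn !sq.
rewrite (mulrC 2 lambda) powRD ?(lt0r_neq0 r0) ?implybT// powRr1 ?(ltW r0)//.
rewrite (_ : 2 - 2 * theta = - theta * 2 + 2); last by ring.
rewrite powRD ?(lt0r_neq0 L0) ?implybT// !powR_mulrn ?(ltW L0)//.
rewrite -/(loginv r); field.
by rewrite !lt0r_neq0.
Qed.

(** The factor [k] is there because on a ray the argument of phi is only
    comparable, up to a factor between two positive constants, with a monotone
    function. *)
Lemma phi_sqr_le (lambda theta M k0 : R) :
  (lambda = - 2^-1 /\ 1 < theta) \/ - 2^-1 < lambda -> 0 < M -> 0 < k0 ->
  exists2 K, 0 <= K & forall k v, k0 <= k <= 1 -> 0 < v -> k * v <= M ->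
    phi lambda theta (k * v) ^+ 2 <= K * log_density v.
Proof.
move=> hlt M0 k00.
have [|K K0 KP] := @powR_bound M (2 * lambda + 1) (2 - 2 * theta) M0.
  move: hlt => [[-> t1]|l]; last by right; lra.
  by left; split; [field|lra].
exists (K / k0 * (1 + 2 * (M / k0))).
  apply: mulr_ge0; first exact: divr_ge0 K0 (ltW k00).
  apply: addr_ge0 => //; apply: mulr_ge0 => //.
  exact: divr_ge0 (ltW M0) (ltW k00).
move=> k v /andP[k0k k1] v0 kvM.
have kp : 0 < k by exact: lt_le_trans k0k.
have kv0 : 0 < k * v by exact: mulr_gt0.
have Lv := loginv_gt0 v0; have Lkv := loginv_gt0 kv0.
rewrite phi_sqrE//.
apply: (@le_trans _ _ (K / (k * v * loginv (k * v) ^+ 2))).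
  by rewrite ler_wpM2r// ?KP ?kv0// invr_ge0 mulr_ge0 ?sqr_ge0// ltW.
have -> : log_density v = (v * loginv v ^+ 2)^-1 / (1 + 2 * v).
  rewrite /log_density; field.
  by rewrite !lt0r_neq0// ?addr_gt0// ?mulr_gt0// ?exprn_gt0.
have D0 : 0 < 1 + 2 * v by rewrite addr_gt0// mulr_gt0.
apply: (@le_trans _ _ (K / k0 * (v * loginv v ^+ 2)^-1)).
  rewrite -[leRHS]mulrA ler_wpM2l// -invfM lef_pV2 ?posrE ?mulr_gt0 ?exprn_gt0//.
  rewrite -[leRHS]mulrA; apply: ler_pM; [exact: ltW| |exact: k0k|].
    by apply: mulr_ge0; [exact: ltW|exact: sqr_ge0].
  rewrite ler_wpM2l ?(ltW v0)// lerXn2r ?nnegrE ?(ltW Lv) ?(ltW Lkv)//.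
  by rewrite loginv_decreasing// ler_piMl// ltW.
rewrite -[leRHS]mulrA ler_wpM2l ?divr_ge0 ?(ltW k00)//.
rewrite [leRHS]mulrCA ler_peMr//.
  by rewrite invr_ge0; apply: mulr_ge0; [exact: ltW|exact: sqr_ge0].
rewrite ler_pdivlMr// mul1r lerD2l ler_pM2l// ler_pdivlMr//.
by rewrite mulrC (le_trans _ kvM)// ler_wpM2r// ltW.
Qed.

Lemma continuous_log_density r : 0 < r -> {for r, continuous (@log_density R)}.
Proof.
move=> r0; have L0 := loginv_gt0 r0.
have x0 : 0 < 2 + r^-1 by rewrite addr_gt0// invr_gt0.
have cL : {for r, continuous (@loginv R)}.
  apply: continuous_comp; last exact: continuous_ln.
  by apply: cvgD; [exact: cvg_cst|apply: cvgV; [exact: lt0r_neq0|exact: cvg_id]].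
apply: cvgV.
  by rewrite lt0r_neq0// mulr_gt0// ?exprn_gt0// addr_gt0// mulr_gt0// exprn_gt0.
apply: cvgM; first exact: cvgM.
apply: cvgD; last exact: cvg_id.
by apply: cvgM; [exact: cvg_cst|apply: cvgM; exact: cvg_id].
Qed.

End log_primitive.

(** * Monotone substitution in the logarithmic density *)

Section radial.
Context (R : realType).
Local Notation leb := (@lebesgue_measure R).

Lemma monotone_of_derive (J : set R) (v dv : R -> R) :
  is_interval J ->
  (forall t, J t -> is_derive t 1 v (dv t)) -> (forall t, J t -> 0 <= dv t) ->
  forall x y, J x -> J y -> x <= y -> v x <= v y.
Proof.
move=> iJ dvP dv0 x y Jx Jy xy.
have sub z : z \in `[x, y] -> J z by rewrite in_itv/=; exact: iJ.
have [z zxy|//|z zxy E] := @MVT_segment R v dv x y xy.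
- by apply: dvP; apply: sub; exact: subset_itv_oo_cc zxy.
- apply: continuous_in_subspaceT => z /set_mem/= zxy.
  by apply/differentiable_continuous/derivable1_diffP; have [] := dvP _ (sub _ zxy).
- rewrite -subr_ge0 E mulr_ge0 ?subr_ge0//.
  by apply: dv0; exact: sub.
Qed.

(** The integrand is the derivative of [sigma * log_primitive (v t)], and
    [log_primitive] is bounded by [1 / ln 2] whatever the range of [v].  Monotonicity of
    [v] is what makes the set where [v] is positive an interval. *)
Lemma log_density_substitution (J : set R) (v dv : R -> R) (sigma : R) :
  is_interval J -> open J -> `|sigma| = 1 ->
  (forall t, J t -> is_derive t 1 v (dv t)) ->
  (forall t, J t -> {for t, continuous dv}) ->
  (forall t, J t -> 0 <= sigma * dv t) ->
  [/\ measurable (J `&` [set t | 0 < v t]),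
      measurable_fun (J `&` [set t | 0 < v t])
        (fun t => sigma * (log_density (v t) * dv t)) &
      (\int[leb]_(t in J `&` [set t | (0 < v t)%R])
        (sigma * (log_density (v t) * dv t))%:E <= (2 / ln 2)%:E)%E].
Proof.
move=> iJ oJ s1 dvP dvc dv0.
have s11 : sigma * sigma = 1.
  by rewrite -expr2 -real_normK ?num_real// s1 expr1n.
have cv t : J t -> {for t, continuous v}.
  by move=> /dvP[/derivable1_diffP/differentiable_continuous].
have mono x y : J x -> J y -> x <= y -> sigma * v x <= sigma * v y.
  apply: (@monotone_of_derive J (fun t => sigma * v t) (fun t => sigma * dv t)) => //.
  by move=> t /dvP h; exact: (is_deriveZ sigma h).
have iE : is_interval (J `&` [set t | 0 < v t]).
  move=> x y [Jx vx] [Jy vy] z /andP[xz zy].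
  have Jz : J z by apply: (iJ _ _ Jx Jy); rewrite xz.
  split => //=.
  have := mono _ _ Jx Jz xz; have := mono _ _ Jz Jy zy.
  have [s0|s0] := leP 0 sigma.
    have -> : sigma = 1 by move: s1; rewrite ger0_norm.
    by rewrite !mul1r => _ h; exact: lt_le_trans h.
  have -> : sigma = - 1 by move: s1; rewrite ltr0_norm// => <-; rewrite opprK.
  by rewrite !mulN1r !lerN2 => h _; exact: lt_le_trans h.
have oE : open (J `&` [set t | 0 < v t]).
  rewrite openE => t [Jt vt]; apply: filterI; first exact: open_nbhs_nbhs.
  exact: (cv _ Jt) (lt_nbhsr vt).
have dF t : (J `&` [set t | 0 < v t]) t ->
    is_derive t 1 (fun t => sigma * log_primitive (v t))
      (sigma * (log_density (v t) * dv t)).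
  move=> [Jt vt].
  have h := @is_derive1_comp R _ v t _ _ (is_derive_log_primitive vt) (dvP _ Jt).
  exact: (is_deriveZ sigma h).
have cF t : (J `&` [set t | 0 < v t]) t ->
    {for t, continuous (fun t : R => sigma * (log_density (v t) * dv t))}.
  move=> [Jt vt]; apply: cvgM; first exact: cvg_cst.
  apply: cvgM; last exact: dvc.
  exact: (continuous_comp (cv _ Jt) (continuous_log_density vt)).
split.
- exact: open_measurable.
- by apply: open_continuous_measurable_fun => // t /set_mem; exact: cF.
rewrite -[2 / _]/(2 * _).
apply: (@integral_derivative_le R _ _ _ _ iE oE dF cF).
- move=> t [Jt vt]; rewrite mulrCA mulr_ge0 ?dv0//.
  exact/ltW/log_density_gt0.
- by rewrite invr_ge0 ltW// ln_two_gt0.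
- by move=> t [Jt vt]; rewrite normrM s1 mul1r log_primitive_le.
Qed.

(** Dividing by [t] is what produces the quantity psi - s psi' of the
    hypothesis. *)
Lemma radial_derive (psi dpsi : R -> R) (rho x1 x2 t : R) : t != 0 ->
  is_derive (t * x1) 1 psi (dpsi (t * x1)) ->
  is_derive t 1 (fun t => rho * (x2 - psi (t * x1) / t))
    (rho * (psi (t * x1) - t * x1 * dpsi (t * x1)) / t ^+ 2).
Proof.
move=> t0 dp.
have scaleE (a b : R) : a *: (b : R^o) = a * b by [].
have dl : is_derive t 1 (fun t => t * x1) x1.
  have h := is_deriveZ x1 (is_derive_id t 1).
  have -> : (fun t => t * x1) = x1 \*: id by apply/funext => z; rewrite /= mulrC.
  by apply: (is_derive_eq h); rewrite scaleE mulr1.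
have dpl := @is_derive1_comp R _ (fun t => t * x1) t _ _ dp dl.
have dV := is_deriveV t0 (is_derive_id t 1).
have h := is_deriveZ rho (is_deriveB (is_derive_cst x2 t 1) (is_deriveM dpl dV)).
apply: (is_derive_eq h); rewrite !scaleE/= mulr1 sub0r.
by field.
Qed.

End radial.

(** * The uniform bound for ray integrals *)

Section radial_bound.
Context (R : realType).
Local Notation leb := (@lebesgue_measure R).

(** The constant is the same for all [xi] because everything is expressed
    through [rho = R0 / |xi|], the largest [t] for which [t xi] can meet the
    support of [b]. *)
Lemma radial_square_integral (a c : R) (psi dpsi : R -> R) (b : R * R -> R[i])
    (lambda theta sigma c0 r0 R0 B0 M : R) :
  (lambda = - 2^-1 /\ 1 < theta) \/ - 2^-1 < lambda ->
  (forall s : R, a < s < c -> is_derive s 1 psi (dpsi s)) ->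
  (forall s : R, a < s < c -> {for s, continuous dpsi}) ->
  `|sigma| = 1 -> 0 < c0 ->
  (forall s, a < s < c -> c0 <= sigma * (psi s - s * dpsi s)) ->
  0 < r0 -> 0 < M ->
  (forall xi, b xi != 0 ->
    [/\ a < xi.1 < c, r0 <= `|xi| <= R0, cabs (b xi) <= B0 & xi.2 - psi xi.1 <= M]) ->
  cmeasurable (Psi psi b lambda theta) ->
  exists A : R, forall xi,
    (\int[leb]_(t in `]0%R, +oo[)
      (cabs (Psi psi b lambda theta (t * xi.1, t * xi.2)) ^+ 2 / t)%:E <= A%:E)%E.
Proof.
move=> hlt dpsiP dpsic s1 c00 c0P r00 M0 bP mPsi.
have [b0|/existsNP[xi1 /eqP bxi1]] := pselect (forall xi, b xi = 0).
  exists 0 => xi; rewrite integral0_eq// => t _.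
  by rewrite /Psi b0 mul0r /cabs ComplexField.Normc.normc0 expr0n/= mul0r.
have R00 : 0 < R0.
  by have [_ /andP[h1 h2] _ _] := bP _ bxi1; exact: lt_le_trans (le_trans h1 h2).
have B00 : 0 <= B0.
  by have [_ _ h _] := bP _ bxi1; exact: le_trans (cabs_ge0 _) h.
have [K K0 KP] := phi_sqr_le hlt M0 (divr_gt0 r00 R00).
pose D := B0 ^+ 2 * K / c0.
have D0 : 0 <= D by rewrite divr_ge0 ?(ltW c00)// mulr_ge0// sqr_ge0.
exists (D * (2 / ln 2)) => -[x1 x2] /=.
have [x0|x0] := eqVneq `|(x1, x2)| 0.
  have /eqP : `|(x1, x2)| == 0 by rewrite x0.
  move=> /normr0_eq0[-> ->].
  rewrite integral0_eq; last first.
    move=> t _; rewrite !mulr0 /Psi.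
    have -> : b (0, 0) = 0.
      apply/eqP; apply: contraT => /bP[_ /andP[+ _] _ _].
      by rewrite (_ : (0, 0) = 0 :> R * R)// normr0 leNgt r00.
    by rewrite mul0r /cabs ComplexField.Normc.normc0 expr0n/= mul0r.
  by rewrite lee_fin mulr_ge0// divr_ge0// ltW// ln_two_gt0.
have n0 : 0 < `|(x1, x2)| by rewrite lt0r x0 normr_ge0.
(* On the support of b the ratio t / rho lies in [r0 / R0, 1], and
   t xi_2 - psi (t xi_1) = (t / rho) v t. *)
pose rho := R0 / `|(x1, x2)|.
have rho0 : 0 < rho by exact: divr_gt0.
pose J := [set t : R | 0 < t /\ a < t * x1 < c].
pose v (t : R) := rho * (x2 - psi (t * x1) / t).
pose dv (t : R) := rho * (psi (t * x1) - t * x1 * dpsi (t * x1)) / t ^+ 2.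
have iJ : is_interval J.
  move=> x y [xp /andP[xa xc]] [yp /andP[ya yc]] z /andP[xz zy].
  split; first exact: lt_le_trans xz.
  have [p|p] := leP 0 x1; apply/andP; split.
  - by apply: (lt_le_trans xa); rewrite ler_wpM2r.
  - by apply: le_lt_trans yc; rewrite ler_wpM2r.
  - by apply: (lt_le_trans ya); rewrite ler_wnM2r// ltW.
  - by apply: le_lt_trans xc; rewrite ler_wnM2r// ltW.
have cl (t : R) : {for t, continuous (fun t : R => t * x1)}.
  by apply: cvgM; [exact: cvg_id|exact: cvg_cst].
have oJ : open J.
  rewrite openE => t [tp /andP[ta tc]].
  apply: filterI; first exact: lt_nbhsr.
  have h1 : \forall s \near t, a < s * x1 by exact: (cl t) (lt_nbhsr ta).
  have h2 : \forall s \near t, s * x1 < c by exact: (cl t) (lt_nbhsl tc).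
  by near=> s; apply/andP; split; near: s.
have dvP t : J t -> is_derive t 1 v (dv t).
  by move=> [tp tJ]; apply: radial_derive; [exact: lt0r_neq0|exact: dpsiP].
have dvc t : J t -> {for t, continuous dv}.
  move=> [tp tJ].
  have cp : {for t, continuous (fun t : R => psi (t * x1))}.
    apply: (continuous_comp (cl t)).
    by apply/differentiable_continuous/derivable1_diffP; have [] := dpsiP _ tJ.
  have cdp : {for t, continuous (fun t : R => dpsi (t * x1))}.
    by apply: (continuous_comp (cl t)); exact: dpsic.
  apply: cvgM.
    apply: cvgM; first exact: cvg_cst.
    by apply: cvgB => //; apply: cvgM => //; exact: cl.
  apply: cvgV; first by rewrite lt0r_neq0// exprn_gt0.
  by apply: cvgM; exact: cvg_id.
(* For t <= rho this is at least c0 / t, which produces the measure dt/t. *)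
have dvlow t : J t -> rho * c0 / t ^+ 2 <= sigma * dv t.
  move=> [tp tJ]; rewrite /dv mulrA ler_wpM2r ?invr_ge0 ?sqr_ge0//.
  by rewrite mulrCA ler_wpM2l ?(ltW rho0)// c0P.
have dv0 t : J t -> 0 <= sigma * dv t.
  move=> tJ; apply: le_trans (dvlow _ tJ).
  by rewrite divr_ge0 ?sqr_ge0// mulr_ge0// ltW.
have [mE mfE main] := log_density_substitution iJ oJ s1 dvP dvc dv0.
pose E := J `&` [set t | 0 < v t].
pose f t := sigma * (log_density (v t) * dv t).
have f0 t : E t -> 0 <= f t.
  by move=> [tJ vt]; rewrite /f mulrCA mulr_ge0 ?dv0// ltW// log_density_gt0.
(* Either the ray integrand vanishes at t, or t lies in E and the integrand is
   dominated by the derivative f. *)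
have pw t : 0 < t ->
    (E t /\ cabs (Psi psi b lambda theta (t * x1, t * x2)) ^+ 2 / t <= D * f t) \/
    (cabs (Psi psi b lambda theta (t * x1, t * x2)) ^+ 2 / t = 0).
  move=> tp; rewrite /Psi cabsM cabs_real.
  have [b0|/bP[tJ /andP[rt tR] bB uM]] := eqVneq (b (t * x1, t * x2)) 0.
    by right; rewrite b0 {1}/cabs ComplexField.Normc.normc0 mul0r expr0n/= mul0r.
  move: tJ bB uM rt tR; cbn [fst snd] => tJ bB uM.
  rewrite -[X in `|X|]/(t *: (x1, x2)) normrZ gtr0_norm// => rt tR.
  have [u0|u0] := leP (t * x2 - psi (t * x1)) 0.
    by right; rewrite /phi ltNge u0/= normr0 mulr0 expr0n/= mul0r.
  have Jt : J t by [].
  have kvE : t / rho * v t = t * x2 - psi (t * x1).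
    by rewrite /v; field; rewrite !lt0r_neq0.
  have k1 : r0 / R0 <= t / rho <= 1.
    rewrite /rho invf_div mulrA ler_pM2r ?invr_gt0// rt/=.
    by rewrite ler_pdivrMr// mul1r.
  have k0 : 0 < t / rho by exact: divr_gt0.
  have vt : 0 < v t by rewrite -(pmulr_rgt0 _ k0) kvE.
  left; split=> //.
  have tV : t^-1 <= sigma * dv t / c0.
    rewrite ler_pdivlMr//; apply: le_trans (dvlow _ Jt).
    rewrite (_ : rho * c0 / t ^+ 2 = (rho / t) * (t^-1 * c0)); last first.
      by field; rewrite lt0r_neq0.
    rewrite ler_peMl ?mulr_ge0 ?invr_ge0 ?(ltW tp) ?(ltW c00)//.
    by rewrite ler_pdivlMr// mul1r /rho ler_pdivlMr.
  have := KP _ _ k1 vt; rewrite kvE => /(_ uM) ph.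
  rewrite exprMn real_normK ?num_real//.
  have ld := ltW (log_density_gt0 vt).
  apply: (@le_trans _ _ (B0 ^+ 2 * (K * log_density (v t)) * (sigma * dv t / c0))).
    apply: ler_pM => //.
    - by apply: mulr_ge0; exact: sqr_ge0.
    - by rewrite invr_ge0 ltW.
    apply: ler_pM => //; try exact: sqr_ge0.
    by rewrite lerXn2r ?nnegrE ?cabs_ge0.
  by rewrite /D /f le_eqVlt; apply/orP; left; apply/eqP; ring.
pose g t := cabs (Psi psi b lambda theta (t * x1, t * x2)) ^+ 2 / t.
have mg : measurable_fun (`]0, +oo[%classic : set R) g.
  apply: (@eq_measurable_fun _ _ _ _ _ (fun t : R =>
      cabs (Psi psi b lambda theta (t * x1, t * x2)) ^+ 2 * t `^ (-1))).
    by move=> t; rewrite mem_pos => tp; rewrite /g powR_inv1 ?ltW//.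
  apply: measurable_funTS; apply: measurable_funM; last exact: measurable_powR.
  apply: measurable_funX; apply: measurable_cabs.
  apply: (cmeasurable_comp (phi := fun t : R => (t * x1, t * x2)) _ mPsi).
  by apply: measurable_fun_pair; exact: measurable_funM.
have g0 t : 0 < t -> 0 <= g t.
  by move=> tp; rewrite divr_ge0 ?sqr_ge0// ltW.
apply: (@le_trans _ _ (\int[leb]_(t in E) (D * f t)%:E)%E).
  rewrite integral_mkcond [leRHS]integral_mkcond.
  apply: ge0_le_integral => //.
  - move=> t _; rewrite patchE; case: ifPn => //; rewrite mem_pos => tp.
    by rewrite lee_fin g0.
  - apply/(measurable_restrictT (fun t => (g t)%:E)) => //.
    exact/measurable_EFinP.
  - apply/(measurable_restrictT (fun t => (D * f t)%:E)); first exact: mE.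
    by apply/measurable_EFinP; exact: measurable_funM.
  - move=> t _; rewrite !patchE mem_pos.
    have [tE|tE] := boolP (t \in E); last first.
      case: ifPn => // /pw[[/mem_set tE' _]|->//].
      by rewrite tE' in tE.
    have [tJ _] := set_mem tE; have [tp _] := tJ; rewrite tp lee_fin.
    have [[_ //]|->] := pw _ tp.
    by rewrite mulr_ge0// f0//; exact: set_mem.
have mEf : measurable_fun E (EFin \o f) by exact/measurable_EFinP.
have fE t : E t -> (0 <= (EFin \o f) t)%E by move=> tE; rewrite lee_fin f0.
have DE : (0 <= D%:E)%E by rewrite lee_fin.
rewrite [leLHS](ge0_integralZl leb mE mEf fE DE).
by rewrite (EFinM D) lee_wpmul2l.
Unshelve. all: by end_near.
Qed.

End radial_bound.

(** * Continuity and derivatives relative to a compact interval *)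

Section continuity.
Context (R : realType).

(** An open set is a countable union of boxes with rational centres and radii
    1/(n+1). *)
Lemma open_measurable_plane (U : set (R * R)) : open U -> measurable U.
Proof.
move=> oU.
pose box (i : rat * rat * nat) : set (R * R) :=
  `](ratr i.1.1 - i.2.+1%:R^-1), (ratr i.1.1 + i.2.+1%:R^-1)[%classic `*`
  `](ratr i.1.2 - i.2.+1%:R^-1), (ratr i.1.2 + i.2.+1%:R^-1)[%classic.
have mbox i : measurable (box i).
  by apply: measurableX; exact: measurable_itv.
have -> : U = \bigcup_i (if `[< box i `<=` U >] then box i else set0).
  apply/seteqP; split; last first.
    by move=> z [i _]; case: asboolP => // sub; exact: sub.
  move=> [x y] Uxy.
  have /nbhs_ballP[e /= e0 eU] : nbhs (x, y) U by exact: open_nbhs_nbhs.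
  have dist (w w' q d : R) : d + d < e -> q - d < w < q + d ->
      q - d < w' < q + d -> `|w - w'| < e.
    by move=> de /andP[? ?] /andP[? ?]; rewrite ltr_norml; apply/andP; split; lra.
  pose n := Num.truncn (2 / e).
  have n0 : 0 < n.+1%:R^-1 :> R by rewrite invr_gt0.
  have ne : n.+1%:R^-1 + n.+1%:R^-1 < e.
    rewrite (_ : _ + _ = 2 / n.+1%:R); last by rewrite mulr_natl mulr2n.
    rewrite ltr_pdivrMr// mulrC -ltr_pdivrMr//.
    exact: truncnS_gt.
  have close (w : R) : exists q : rat, ratr q - n.+1%:R^-1 < w < ratr q + n.+1%:R^-1.
    have /rat_in_itvoo[q] : w - n.+1%:R^-1 < w + n.+1%:R^-1.
      by rewrite ltrBlDr -addrA ltrDl addr_gt0.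
    rewrite in_itv/= => /andP[h1 h2]; exists q.
    by rewrite ltrBlDr h2/= -ltrBlDr.
  have [[q1 q1x] [q2 q2y]] := (close x, close y).
  exists (q1, q2, n) => //.
  case: asboolP => [_|]; first by split => /=; rewrite in_itv.
  apply: contra_notP => _ [x' y'] [/=]; rewrite !in_itv/= => x'q y'q.
  by apply: eU; split; [exact: dist ne q1x x'q|exact: dist ne q2y y'q].
apply: countable_bigcupT_measurable => // i.
by case: asboolP.
Qed.

Lemma continuous_measurable_plane (f : R * R -> R) :
  continuous f -> measurable_fun setT f.
Proof.
move=> /continuousP cf; apply: (measurability _ (RGenOpens.measurableE R)).
move=> _ [_ [a [b ->] <-]]; rewrite setTI; apply: open_measurable_plane.
exact/cf/interval_open.
Qed.

(** At an end point this is one-sided continuity, as it should be on a compact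
    interval. *)
Lemma derivable_within_continuous (A : set R) (f : R -> R) :
  (forall x, A x -> derivable_within A f x) -> {within A, continuous f}.
Proof.
move=> df; apply/subspace_continuousP => x Ax.
have /cvg_ex[l dl] := df _ Ax.
have h : (f x + difference_quotient f x y * (y - x)) @[y --> within A x^'] --> f x.
  rewrite -[X in _ --> X]addr0 -[X in _ + X](mulr0 l) -[X in _ * X](subrr x).
  apply: cvgD; first exact: cvg_cst.
  apply: cvgM => //; apply: cvgB; last exact: cvg_cst.
  by do 2 apply: cvg_within_filter.
apply/cvgrPdist_lt => e e0; move/cvgrPdist_lt : h => /(_ e e0).
rewrite /dnbhs !near_withinE => h; rewrite near_simpl; apply: filterS h => y yh Ay.
have [->|yx] := eqVneq y x; first by rewrite subrr normr0.
have := yh yx Ay.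
by rewrite /difference_quotient divfK ?subr_eq0// addrCA subrr addr0.
Qed.

Lemma is_derive_within_interior (A : set R) (f : R -> R) (x : R) :
  A° x -> derivable_within A f x -> is_derive x 1 f (derive_within A f x).
Proof.
move=> Ax df; apply/is_derive1_caratheodory.
exists (fun y => if y == x then derive_within A f x else difference_quotient f x y).
split; last by rewrite eqxx.
  move=> z; have [->|zx] := eqVneq z x; first by rewrite !subrr mulr0.
  by rewrite /difference_quotient divfK// subr_eq0.
apply/continuous_withinNx; rewrite eqxx.
have h : difference_quotient f x y @[y --> within A x^'] --> derive_within A f x.
  exact: df.
apply/cvgrPdist_lt => e e0; move/cvgrPdist_lt : h => /(_ e e0).
rewrite /dnbhs !near_withinE => h; rewrite near_simpl.
apply: filterS2 Ax h => y Ay yh yx.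
by rewrite (negbTE yx); exact: yh.
Qed.

(** The sign is constant by the intermediate value theorem, and the minimum is
    attained by compactness. *)
Lemma sign_of_nonvanishing (g : R -> R) (a c : R) : a <= c ->
  {within `[a, c], continuous g} -> (forall t, t \in `[a, c] -> g t != 0) ->
  exists sigma c0 : R, [/\ `|sigma| = 1, 0 < c0 &
    forall t, t \in `[a, c] -> c0 <= sigma * g t].
Proof.
move=> ac cg g0.
have ain : a \in `[a, c] by rewrite in_itv/= lexx.
pose sigma := Num.sg (g a).
have cs : {within `[a, c], continuous (fun t => sigma * g t)}.
  by move=> t; apply: cvgM; [exact: cvg_cst|exact: cg].
have [m mac mP] := EVT_min ac cs.
exists sigma, (sigma * g m); split => //.
  by rewrite normr_sg g0.
have sa : 0 < sigma * g a by rewrite -normrEsg normr_gt0 g0.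
have sm : sigma * g m != 0 by rewrite mulf_neq0 ?sgr_eq0 ?g0.
rewrite lt_neqAle eq_sym sm/= leNgt; apply/negP => sm0.
have am : a <= m by move: mac; rewrite in_itv/= => /andP[].
have cm : m <= c by move: mac; rewrite in_itv/= => /andP[].
have cs' : {within `[a, m], continuous (fun t => sigma * g t)}.
  apply: continuous_subspaceW cs => t/=; rewrite !in_itv/= => /andP[-> tm].
  exact: le_trans cm.
have [|t tam] := @IVT R _ a m 0 am cs'.
  by rewrite ge_min le_max (ltW sm0) (ltW sa) orbT.
move=> /eqP; apply/negP; rewrite mulf_neq0 ?sgr_eq0 ?g0//.
by move: tam; rewrite !in_itv/= => /andP[-> tm]; exact: le_trans cm.
Qed.

End continuity.

(** * Schwartz functions and the cut-off function *)

Section inputs.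
Context (R : realType).
Local Notation leb := (@lebesgue_measure R).
Local Notation mu2 := (@lebesgue2 R).

Lemma csmooth2_continuous (f : R * R -> R[i]) : csmooth2 f ->
  continuous (fun x => complex.Re (f x)) /\ continuous (fun x => complex.Im (f x)).
Proof. by move=> [/(_ [::])[? _] /(_ [::])[? _]]. Qed.

Lemma csmooth2_measurable (f : R * R -> R[i]) : csmooth2 f -> cmeasurable f.
Proof.
by move=> /csmooth2_continuous[c1 c2]; split; exact: continuous_measurable_plane.
Qed.

Lemma cpartials0 (f : R * R -> R[i]) x : cpartials [::] f x = f x.
Proof. by rewrite /cpartials/=; case: (f x). Qed.

Lemma integrable_oneDsqrV : leb.-integrable setT (EFin \o (fun y : R => (1 + y ^+ 2)^-1)).
Proof.
apply/integrableP; split.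
  by apply/measurable_EFinP; exact: measurable_oneDsqrV.
apply: (@le_lt_trans _ _ (20 / 1)%:E); last exact: ltry.
apply: le_trans (integral_oneDsqrV_affine 0 (@ltr01 R) ltr01).
apply: ge0_le_integral => //.
- by apply/measurable_EFinP; apply: measurableT_comp => //; exact: measurable_oneDsqrV.
- apply/measurable_EFinP; apply: measurable_funM => //; apply: measurable_oneDsqrV.
  by do 2 apply: measurable_funM => //; exact: measurable_funD.
- move=> y _; have d0 : 0 < 1 + y ^+ 2 by rewrite ltr_pwDl// sqr_ge0.
  rewrite /= lee_fin ger0_norm ?invr_ge0 ?(ltW d0)// !mul1r addr0 mulr1.
  by rewrite ler_peMl ?invr_ge0 ?(ltW d0)// ler1n.
Qed.

(** Four decay estimates, with exponents 0 and 2 in each variable, bound [f]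
    by a multiple of the integrable function 1 / ((1 + x_1^2) (1 + x_2^2)). *)
Lemma schwartz_cintegrable (f : R * R -> R[i]) : schwartz f -> cintegrable f.
Proof.
move=> [sf decay].
have [C00 h00] := decay 0%N 0%N [::]; have [C20 h20] := decay 2%N 0%N [::].
have [C02 h02] := decay 0%N 2%N [::]; have [C22 h22] := decay 2%N 2%N [::].
pose w (y : R) := (1 + y ^+ 2)^-1.
have w0 y : 0 < 1 + y ^+ 2 :> R by rewrite ltr_pwDl// sqr_ge0.
have mw : measurable_fun setT w by exact: measurable_oneDsqrV.
pose C := C00 + C20 + C02 + C22.
apply: (@cintegrable_dominated _ _ (fun x => C * (w x.1 * w x.2))).
- exact: csmooth2_measurable.
- apply: integrable_scale.
  apply: (@integrable_tensor _ _ _ _ R leb leb _ w w).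
  + by apply: measurable_funM; exact: measurableT_comp.
  + exact: integrable_oneDsqrV.
  + exact: integrable_oneDsqrV.
  + by move=> x y; rewrite ger0_norm// mulr_ge0// invr_ge0 ltW.
- move=> x; rewrite -invfM ler_pdivlMr ?mulr_gt0//.
  have := h00 x; have := h20 x; have := h02 x; have := h22 x.
  rewrite !cpartials0 !expr0 !real_normK ?num_real// !mul1r !mulr1.
  by rewrite /C; set z := cabs _; lra.
Qed.

Lemma prod_norm_lt (x : R * R) (e : R) : `|x| < e = (`|x.1| < e) && (`|x.2| < e).
Proof. by rewrite {1}/Num.norm/= gt_max. Qed.

Lemma compact_support_bounds (a c : R) (b : R * R -> R[i]) :
  smooth_compact_support b ->
  csupport b `<=` `[a, c]^° `*` setT ->
  (\forall xi \near nbhs ((0, 0) : R * R), b xi = 0) ->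
  exists r0 R0 B0 : R, 0 < r0 /\ forall xi, b xi != 0 ->
    [/\ a < xi.1 < c, r0 <= `|xi| <= R0 & cabs (b xi) <= B0].
Proof.
move=> [sb cb] bI b0.
have sub xi : b xi != 0 -> csupport b xi by move=> h; exact: subset_closure.
have [cR cI] := csmooth2_continuous sb.
have /nbhs_ballP[r0 /= r00 r0P] := b0.
have [R0 [_ R0P]] := compact_bounded cb.
have bnd (f : R * R -> R) : continuous f -> exists B, forall xi, csupport b xi -> `|f xi| <= B.
  move=> cf.
  have : compact (f @` csupport b).
    by apply: continuous_compact => //; exact: continuous_subspaceT.
  move=> /(@compact_bounded R R)[B [_ BP]]; exists (B + 1) => xi xib.
  by apply: (BP (B + 1)); rewrite ?ltrDl//; exists xi.
have [BR BRP] := bnd _ cR; have [BI BIP] := bnd _ cI.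
exists r0, (R0 + 1), (BR + BI); split => // xi bxi; have xis := sub _ bxi.
split.
- by have [] := bI _ xis; rewrite interior_itv_bnd/= in_itv.
- apply/andP; split; last by apply: (R0P (R0 + 1)); rewrite ?ltrDl.
  rewrite leNgt; apply/negP => xr; move: bxi; rewrite r0P ?eqxx//.
  move: xr; rewrite prod_norm_lt => /andP[h1 h2].
  by split; rewrite /ball/= sub0r normrN.
- by rewrite (le_trans (cabs_le _))// lerD// ?BRP ?BIP.
Qed.

End inputs.

(** * Measurability and integrability of the symbol *)

Section multiplier_symbol.
Context (R : realType).
Local Notation leb := (@lebesgue_measure R).
Local Notation mu2 := (@lebesgue2 R).

Lemma measurable_phi (lambda theta : R) : measurable_fun setT (phi lambda theta).
Proof.
have -> : phi lambda theta = (fun r : R => if 0 < r then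
    r `^ lambda * ln (2 + r `^ (-1)) `^ (- theta) else 0).
  by apply/funext => r; rewrite /phi; case: ifPn => // r0; rewrite powR_inv1 ?ltW//.
apply: measurable_fun_ifT => //.
  exact: measurable_fun_ltr.
apply: measurable_funM; first exact: measurable_powR.
apply: (measurableT_comp (measurable_powR _)); apply: measurableT_comp => //.
by apply: measurable_funD => //; exact: measurable_powR.
Qed.

Lemma Psi_eq_on (psi psi' : R -> R) (b : R * R -> R[i]) (lambda theta : R) :
  (forall xi, b xi != 0 -> psi xi.1 = psi' xi.1) ->
  Psi psi b lambda theta = Psi psi' b lambda theta.
Proof.
move=> bpsi; apply/funext => xi; rewrite /Psi.
by have [->|/bpsi ->] := eqVneq (b xi) 0; rewrite ?mul0r.
Qed.

Lemma cmeasurable_Psi (psi : R -> R) (b : R * R -> R[i]) (lambda theta : R) :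
  measurable_fun setT psi -> cmeasurable b ->
  cmeasurable (Psi psi b lambda theta).
Proof.
move=> mpsi mb; apply: cmeasurableM => //; apply: cmeasurable_real.
apply: (measurableT_comp (measurable_phi _ _)); apply: measurable_funB => //.
exact: measurableT_comp.
Qed.

Lemma integral_indic_ball (r : R) : 0 <= r ->
  (\int[leb]_y (\1_(`[- r, r]%classic) y)%:E = (2 * r)%:E)%E.
Proof.
move=> r0; rewrite integral_indic//= setIT lebesgue_measure_itv/= lte_fin.
case: ifPn => [_|]; first by rewrite -EFinB opprK mulr_natl.
rewrite -leNgt => h; have -> : r = 0 by apply/eqP; rewrite eq_le r0 andbT; lra.
by rewrite mulr0.
Qed.

(** On each vertical line phi is at most 1 + phi^2, and phi^2 is dominated by a
    translate of [log_density], whose integral does not depend on the line. *)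
Lemma cintegrable_Psi (psi : R -> R) (b : R * R -> R[i])
    (lambda theta R0 B0 M : R) :
  (lambda = - 2^-1 /\ 1 < theta) \/ - 2^-1 < lambda ->
  measurable_fun setT psi -> cmeasurable b -> 0 < M ->
  (forall xi, b xi != 0 ->
    [/\ `|xi| <= R0, cabs (b xi) <= B0 & xi.2 - psi xi.1 <= M]) ->
  cintegrable (Psi psi b lambda theta).
Proof.
move=> hlt mpsi mb M0 bP.
have mPsi := cmeasurable_Psi lambda theta mpsi mb.
have mc := measurable_cabs mPsi.
apply/(cintegrableP mPsi)/integrableP; split; first exact/measurable_EFinP.
have [b0|/existsNP[xi1 /eqP bxi1]] := pselect (forall xi, b xi = 0).
  rewrite integral0_eq// => xi _ /=.
  by rewrite /Psi b0 mul0r /cabs ComplexField.Normc.normc0 normr0.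
have R00 : 0 <= R0.
  by have [h _ _] := bP _ bxi1; exact: le_trans (normr_ge0 _) h.
have B00 : 0 <= B0.
  by have [_ h _] := bP _ bxi1; exact: le_trans (cabs_ge0 _) h.
have [K K0 KP] := phi_sqr_le hlt M0 (@ltr01 R).
pose I (y : R) : R := \1_(`[- R0, R0]%classic) y.
have mI : measurable_fun setT I by exact: measurable_indic.
have I0 y : 0 <= I y by [].
have I1 (y : R) : `|y| <= R0 -> I y = 1.
  by move=> yR; rewrite /I indicE mem_set//= in_itv/= -ler_norml.
(* The part of the line {x} x R above the curve, where p = psi x. *)
pose E p : set R := setT `&` [set t | 0 < t - p].
pose f p t : R := 1 * (log_density (t - p) * 1).
have sub p : [/\ measurable (E p), measurable_fun (E p) (f p) &
    (\int[leb]_(t in E p) (f p t)%:E <= (2 / ln 2)%:E)%E].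
  apply: (@log_density_substitution R setT (fun t => t - p) (fun=> 1) 1) => //.
  - exact: openT.
  - exact: normr1.
  - move=> t _; have h := is_deriveB (is_derive_id t 1) (is_derive_cst p t 1).
    by apply: (is_derive_eq h); rewrite subr0.
  - by move=> t _; exact: cvg_cst.
have f0 p t : E p t -> 0 <= f p t.
  by move=> [_ tp]; rewrite /f mul1r mulr1 ltW// log_density_gt0.
pose fE p : R -> \bar R := (EFin \o f p) \_ (E p).
have fE0 p t : (0 <= fE p t)%E.
  by rewrite /fE patchE; case: ifPn => // /set_mem tE; rewrite lee_fin f0.
have mfE p : measurable_fun setT (fE p).
  have [mE mf _] := sub p.
  by apply/(measurable_restrictT (EFin \o f p)) => //; exact/measurable_EFinP.
have ifE p : (\int[leb]_t fE p t <= (2 / ln 2)%:E)%E.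
  by have [_ _] := sub p; rewrite integral_mkcond.
pose C := B0 * (2 * R0) + B0 * K * (2 / ln 2).
have mEI : measurable_fun setT (EFin \o I) by exact/measurable_EFinP.
have m1 : measurable_fun setT (fun y => B0%:E * (I y)%:E)%E.
  by apply: emeasurable_funM => //; exact: mEI.
have m2 p : measurable_fun setT (fun y => (B0 * K)%:E * fE p y)%E.
  by apply: emeasurable_funM => //; exact: mfE.
have m12 p : measurable_fun setT
    (fun y => B0%:E * (I y)%:E + (B0 * K)%:E * fE p y)%E.
  exact: emeasurable_funD.
have BK0 : 0 <= B0 * K by exact: mulr_ge0.
have pw x y : ((cabs (Psi psi b lambda theta (x, y)))%:E <=
    (I x)%:E * (B0%:E * (I y)%:E + (B0 * K)%:E * fE (psi x) y))%E.
  have G0 : (0 <= B0%:E * (I y)%:E + (B0 * K)%:E * fE (psi x) y)%E.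
    by rewrite adde_ge0// mule_ge0// lee_fin.
  rewrite /Psi cabsM cabs_real.
  have [->|bxy] := eqVneq (b (x, y)) 0.
    rewrite {1}/cabs ComplexField.Normc.normc0 mul0r mule_ge0// lee_fin.
    exact: I0.
  have [+ bB uM] := bP _ bxy.
  rewrite {1}/Num.norm/= ge_max => /andP[xR yR].
  rewrite (I1 _ xR) (I1 _ yR) mul1e mule1.
  have phi1 : `|phi lambda theta (y - psi x)| <= 1 + phi lambda theta (y - psi x) ^+ 2.
    rewrite -(real_normK (num_real (phi _ _ _))).
    by have := sqr_ge0 (`|phi lambda theta (y - psi x)| - 2^-1); nra.
  apply: (@le_trans _ _ (B0 * (1 + phi lambda theta (y - psi x) ^+ 2))%:E).
    by rewrite lee_fin ler_pM// ?cabs_ge0.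
  rewrite mulrDr mulr1 EFinD leeD2l//.
  have [u0|u0] := leP (y - psi x) 0.
    rewrite /phi ltNge u0/= expr0n/= mulr0.
    by rewrite mule_ge0.
  have := KP 1 (y - psi x); rewrite mul1r lexx => /(_ isT u0 uM) h.
  rewrite /fE patchE mem_set//= -EFinM lee_fin /f mul1r mulr1 -mulrA.
  by rewrite ler_wpM2l.
have inner x : (\int[leb]_y (cabs (Psi psi b lambda theta (x, y)))%:E <= (I x)%:E * C%:E)%E.
  apply: (@le_trans _ _ (\int[leb]_y ((I x)%:E * (B0%:E * (I y)%:E + (B0 * K)%:E * fE (psi x) y)))%E).
    apply: ge0_le_integral => //.
    - by move=> y _; rewrite lee_fin cabs_ge0.
    - apply/measurable_EFinP.
      apply: (@measurableT_comp _ _ _ _ _ _ _ _ (fun y => (x, y)) mc).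
      exact: measurable_fun_pair.
    - by apply: emeasurable_funM => //; exact: m12.
  rewrite (ge0_integralZl leb measurableT (m12 (psi x))); last 2 first.
  - by move=> y _; rewrite adde_ge0// mule_ge0// lee_fin.
  - by rewrite lee_fin; exact: I0.
  rewrite lee_wpmul2l ?lee_fin//.
  have g1 y : setT y -> (0 <= B0%:E * (I y)%:E)%E by move=> _; rewrite mule_ge0// lee_fin.
  have g2 y : setT y -> (0 <= (B0 * K)%:E * fE (psi x) y)%E.
    by move=> _; rewrite mule_ge0// lee_fin.
  rewrite (ge0_integralD leb measurableT g1 m1 g2 (m2 _)).
  rewrite /C EFinD leeD//.
    rewrite (ge0_integralZl leb measurableT mEI) ?lee_fin//; last first.
      by move=> y _; rewrite lee_fin.
    by rewrite integral_indic_ball// EFinM.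
  rewrite (ge0_integralZl leb measurableT (mfE _)) ?lee_fin//.
  by rewrite (EFinM (B0 * K)) lee_wpmul2l ?lee_fin.
have C0 : 0 <= C.
  by rewrite addr_ge0// !mulr_ge0// invr_ge0 ltW// ln_two_gt0.
apply: (@le_lt_trans _ _ ((2 * R0)%:E * C%:E)%E); last by rewrite -EFinM ltry.
have mEc : measurable_fun setT (fun z => `|(EFin \o (fun x => cabs (Psi psi b lambda theta x))) z|%E).
  by apply: measurableT_comp => //; exact/measurable_EFinP.
rewrite ge0_integral_lebesgue2//=.
apply: (@le_trans _ _ (\int[leb]_x ((I x)%:E * C%:E))%E).
  apply: ge0_le_integral => //.
  - by move=> x _; apply: integral_ge0 => y _; rewrite lee_fin.
  - exact: (@measurable_fun_fubini_tonelli_F _ _ _ _ R leb _ mEc (fun x => abse_ge0 _)).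
  - exact: emeasurable_funM.
  move=> x _; apply: le_trans (inner x).
  rewrite le_eqVlt; apply/orP; left; apply/eqP; apply: eq_integral => y _.
  by rewrite ger0_norm// cabs_ge0.
rewrite ge0_integralZr//; last by move=> y _; rewrite lee_fin.
by rewrite integral_indic_ball.
Qed.

End multiplier_symbol.

(** * The estimate for the square function *)

Lemma norm2_sqr (R : realType) (F : R * R -> \bar R) (G : R * R -> \bar R) :
  (forall x, 0 <= G x)%E -> (forall x, `|F x| `^ 2 = G x)%E ->
  norm2 F = ((\int[@lebesgue2 R]_x G x) `^ 2^-1)%E.
Proof.
move=> G0 FG; rewrite /norm2 unlock; congr (_ `^ _)%E.
by apply: eq_integral => x _; rewrite FG.
Qed.

Lemma littlewood_paley_norm2 (R : realType) (h f : R * R -> R[i]) :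
  norm2 (littlewood_paley h f) =
  ((\int[@lebesgue2 R]_x \int[@lebesgue_measure R]_(t in `]0%R, +oo[)
    (cabs (convolution (dilation h t) f x) ^+ 2 / t)%:E) `^ 2^-1)%E.
Proof.
apply: norm2_sqr => x.
  apply: integral_ge0 => t/=; rewrite in_itv/= andbT => t0.
  by rewrite lee_fin divr_ge0 ?sqr_ge0// ltW.
rewrite /littlewood_paley gee0_abs ?poweR_ge0// -poweRrM mulVf// poweRe1//.
apply: integral_ge0 => t/=; rewrite in_itv/= andbT => t0.
by rewrite lee_fin divr_ge0 ?sqr_ge0// ltW.
Qed.

Lemma cabs_norm2 (R : realType) (f : R * R -> R[i]) :
  norm2 (fun x => (cabs (f x))%:E) =
  ((\int[@lebesgue2 R]_x (cabs (f x) ^+ 2)%:E) `^ 2^-1)%E.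
Proof.
apply: norm2_sqr => x; first by rewrite lee_fin sqr_ge0.
by rewrite gee0_abs ?lee_fin ?cabs_ge0// poweR_EFin powR_mulrn// cabs_ge0.
Qed.

Theorem theorem1p7 (R : realType) (a c : R) (psi : R -> R)
    (b : R * R -> R[i]) (lambda theta : R)
    (hac : a <= c)
    (hpsi : smooth_within `[a, c] psi)
    (hpsi' : forall t : R, t \in `[a, c] ->
      psi t - t * derive_within `[a, c] psi t != 0)
    (hb : smooth_compact_support b)
    (hbI : csupport b `<=` `[a, c]^° `*` setT)
    (hb0 : \forall xi \near nbhs ((0, 0) : R * R), b xi = 0)
    (hlt : (lambda = - 2^-1 /\ 1 < theta) \/ - 2^-1 < lambda) :
  exists C : R, forall f : R * R -> R[i], schwartz f ->
    (norm2 (littlewood_paley (inverse_fourier (Psi psi b lambda theta)) f)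
      <= C%:E * norm2 (fun x => (cabs (f x))%:E))%E.
Proof.
pose dpsi := derive_within `[a, c] psi.
have [r0 [R0 [B0 [r00 bP]]]] := compact_support_bounds hb hbI hb0.
have mb : cmeasurable b by case: hb => sb _; exact: csmooth2_measurable.
have cpsi : {within `[a, c], continuous psi}.
  by apply: derivable_within_continuous => x; exact: (hpsi 0%N).
have cdpsi : {within `[a, c], continuous dpsi}.
  by apply: derivable_within_continuous => x; exact: (hpsi 1%N).
have inside s : a < s < c -> `[a, c]^° s.
  by rewrite interior_itv_bnd/= in_itv.
have sub s : a < s < c -> s \in `[a, c].
  by rewrite in_itv/= => /andP[/ltW-> /ltW->].
have dP s : a < s < c -> is_derive s 1 psi (dpsi s).
  by move=> sac; apply: is_derive_within_interior; [exact: inside|exact: (hpsi 0%N _ (sub _ sac))].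
have dc s : a < s < c -> {for s, continuous dpsi}.
  move=> sac; apply/differentiable_continuous/derivable1_diffP.
  by have [] := is_derive_within_interior (inside _ sac) (hpsi 1%N _ (sub _ sac)).
have cg : {within `[a, c], continuous (fun t => psi t - t * dpsi t)}.
  move=> t; apply: cvgB; first exact: cpsi.
  apply: cvgM; last exact: cdpsi.
  by apply: continuous_subspaceT => x; exact: cvg_id.
have [sigma [c0 [s1 c00 c0P]]] := sign_of_nonvanishing hac cg hpsi'.
have [m _ mP] := EVT_min hac cpsi.
(* An upper bound for xi_2 - psi xi_1 on the support of b. *)
pose M := `|R0| + `|psi m| + 1.
have M0 : 0 < M by rewrite ltr_wpDl// addr_ge0.
have bM xi : b xi != 0 -> xi.2 - psi xi.1 <= M.
  move=> bxi; have [xac /andP[_ xR] _] := bP _ bxi.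
  have h1 : xi.2 <= `|R0|.
    rewrite (le_trans (ler_norm _))// (le_trans _ (ler_norm _))// (le_trans _ xR)//.
    by rewrite [leRHS]/Num.norm/= le_max lexx orbT.
  have h2 := mP _ (sub _ xac).
  have h3 : - psi m <= `|psi m| by rewrite -normrN ler_norm.
  by rewrite /M; lra.
(* Nothing is known about psi outside [a, c], not even measurability; the symbol
   does not see those values. *)
pose psi0 := psi \_ `[a, c].
have mpsi0 : measurable_fun setT psi0.
  apply/(measurable_restrictT psi) => //.
  exact: subspace_continuous_measurable_fun.
have psi0E xi : b xi != 0 -> psi xi.1 = psi0 xi.1.
  by move=> /bP[/sub xac _ _]; rewrite /psi0 patchE mem_set.
have PsiE := Psi_eq_on lambda theta psi0E.
have iPsi : cintegrable (Psi psi b lambda theta).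
  rewrite PsiE; apply: (@cintegrable_Psi _ _ _ _ _ R0 B0 M) => // xi bxi.
  by rewrite -psi0E//; have [_ /andP[_ ?] ?] := bP _ bxi; split => //; exact: bM.
have c0P' s : a < s < c -> c0 <= sigma * (psi s - s * dpsi s).
  by move=> /sub; exact: c0P.
have bP' xi : b xi != 0 ->
    [/\ a < xi.1 < c, r0 <= `|xi| <= R0, cabs (b xi) <= B0 & xi.2 - psi xi.1 <= M].
  by move=> bxi; have [? ? ?] := bP _ bxi; split => //; exact: bM.
have [A AP] := radial_square_integral hlt dP dc s1 c00 c0P' r00 M0 bP'
  (cintegrable_measurable iPsi).
pose K := (160 / pi) ^+ 2 * A * (320 / - (2 * pi)) ^+ 2.
exists (K `^ 2^-1) => f sf.
rewrite littlewood_paley_norm2 cabs_norm2.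
have A0 : 0 <= A.
  rewrite -lee_fin; apply: le_trans (AP (0, 0)); apply: integral_ge0 => t/=.
  by rewrite in_itv/= andbT => t0; rewrite lee_fin divr_ge0 ?sqr_ge0// ltW.
have K0 : 0 <= K by rewrite mulr_ge0 ?sqr_ge0// mulr_ge0 ?sqr_ge0.
rewrite -poweR_EFin -poweRM ?lee_fin//; last first.
  by apply: integral_ge0 => x _; rewrite lee_fin sqr_ge0.
have main := littlewood_paley_multiplier iPsi (schwartz_cintegrable sf) AP.
have pos (u : R * R -> \bar R) : (forall x, 0 <= u x)%E ->
    (\int[@lebesgue2 R]_x u x)%E \in `[0%E, +oo%E].
  by move=> u0; rewrite in_itv/= leey andbT; exact: integral_ge0.
apply: gt0_ler_poweR main; rewrite ?invr_ge0//.
- apply: pos => x; apply: integral_ge0 => t/=; rewrite in_itv/= andbT => t0.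
  by rewrite lee_fin divr_ge0 ?sqr_ge0// ltW.
- rewrite in_itv/= leey andbT mule_ge0// ?lee_fin//.
  by apply: integral_ge0 => x _; rewrite lee_fin sqr_ge0.
Qed.
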